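(* Let $v_1,\ldots,v_n\in\mathbb{R}^d$ satisfy $\|v_i\|_2\leq 1$ for all $i\in[n]$. Run the Gram-Schmidt walk algorithm (described in the context) on the $d\times n$ matrix $M$ with columns $v_1,\ldots,v_n$, and let $Z_{e_1},\ldots,Z_{e_d}$ (with $e_1,\ldots,e_d$ the standard basis of $\mathbb{R}^d$) and $\hat T$ be the random variables associated with this run, as defined in the context. Then $0\leq Z_{e_i}\leq 1$ for all $1\leq i\leq d$, $\hat T\leq\min\{d,n\}$, and there exists a sequence of signs $(X_i)_{i=1}^n\in\{-1,1\}^n$ such that \[ \left\|\sum_{i=1}^n v_iX_i\right\|_\infty\leq 2\max\left(1,\ \sqrt{2\,\mathbf{E}\max_{1\leq i\leq d}Z_{e_i}}\ \sqrt{\log\mathbf{E}\hat T}\right). \]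
   Context: Notation: $[n]=\{1,\ldots,n\}$, and $\langle\cdot,\cdot\rangle$ is the Euclidean inner product. Gram-Schmidt walk (GSW) algorithm for a $d\times n$ matrix $M$ with columns $v_1,\ldots,v_n$. Set $X_1=\mathbf 0\in[-1,1]^n$, $t=1$, $\mathcal A_1=[n]$ (unfrozen indices), pivot $\boldsymbol{p}_1=n$. While $\mathcal A_t\neq\emptyset$: (1) let $u_t$ be a minimizer of $\|Mu\|_2$ over $u\in\mathbb{R}^n$ with $u(\boldsymbol p_t)=1$ and $u(i)=0$ for all $i\notin\mathcal A_t$ (chosen by a fixed rule if not unique); (2) let $\Delta=\{\delta\in\mathbb{R}: X_t+\delta u_t\in[-1,1]^n\}$, $\delta^+=|\max\Delta|$, $\delta^-=|\min\Delta|$; (3) let (with fresh randomness) $\delta_t=\delta^+$ with probability $\delta^-/(\delta^-+\delta^+)$ and $\delta_t=-\delta^-$ with probability $\delta^+/(\delta^-+\delta^+)$; (4) set $X_{t+1}=X_t+\delta_tu_t$, $\mathcal A_{t+1}=\{i\in[n]:|X_{t+1}(i)|<1\}$, $\boldsymbol p_{t+1}=\max\mathcal A_{t+1}$ (if $\mathcal A_{t+1}\ne\emptyset$), and increase $t$ by $1$. The output is $X=X_{T+1}\in\{\pm1\}^n$, where $T$ is the random number of steps, i.e. $\mathcal A_{T+1}=\emptyset$ for the first time; $T\leq n$. Pivots. $\mathcal P\subseteq[n]$ is the (random) set of indices that become pivots; for $\boldsymbol p\in\mathcal P$, $I_{\boldsymbol p}=\{t\leq T:\boldsymbol p_t=\boldsymbol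 p\}$ and $t_{\boldsymbol p}=\min I_{\boldsymbol p}$. Index $i$ is frozen in step $t$ if $i\in\mathcal A_t\setminus\mathcal A_{t+1}$. Order. The (random) permutation $\sigma$ of $[n]$ is built by assigning the values $\sigma(n),\sigma(n-1),\ldots,\sigma(1)$ successively: for $t=1,2,\ldots,T$, if $\boldsymbol p_t$ is a new pivot (or $t=1$), then the next value is $\boldsymbol p_t$; after that, the next values are the indices $j\neq\boldsymbol p_t$ frozen in step $t$, in decreasing order. Orthogonalisation. For $r=1,\ldots,n$, let $A_r$ be the orthogonal projection onto $\mathrm{Lin}(v_{\sigma(1)},\ldots,v_{\sigma(r-1)})$ (so $A_1=0$) and $w_{\sigma(r)}=\frac{v_{\sigma(r)}-A_rv_{\sigma(r)}}{\|v_{\sigma(r)}-A_rv_{\sigma(r)}\|_2}$, with $w_{\sigma(r)}=0$ if the numerator is $0$. Index sets. For $\boldsymbol p\in\mathcal P$ and integers $t\geq t_{\boldsymbol p}-1$: $Q^{\boldsymbol p}_{t}=\{\sigma^{-1}(\boldsymbol p)\}$ if $t=t_{\boldsymbol p}-1$; $Q^{\boldsymbol p}_t=\{\sigma^{-1}(j): j\in\mathcal A_t\setminus\mathcal A_{t+1},\ j\neq\boldsymbol p\}$ if $t\in I_{\boldsymbol p}$; $Q^{\boldsymbol p}_t=\emptyset$ otherwise. For $v\in\mathbb{R}^d$ define the random variable \[ Z_v=\sum_{\boldsymbol p\in\mathcal P}\left(\sum_{s=t_{\boldsymbol p}-1}^{n}\left|\sum_{r\in Q^{\boldsymbol p}_s}\langle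 w_{\sigma(r)},v_{\boldsymbol p}\rangle\langle w_{\sigma(r)},v\rangle\right|\right)^2 . \] The number of nontrivial steps is $\hat T=\sum_{\boldsymbol p\in\mathcal P}L_{\boldsymbol p}$, where $L_{\boldsymbol p}$ is the number of $t\in\{t_{\boldsymbol p}-1,t_{\boldsymbol p},\ldots,n\}$ such that $Q^{\boldsymbol p}_t$ contains some $r$ with $w_{\sigma(r)}\neq0$ (indices with $w_{\sigma(r)}=0$ give no new orthogonal vector and are not counted). If all $v_i=0$ (so $\hat T=0$), the right-hand side of the bound is understood as $2$. *)

(* Defs.v *)
From mathcomp Require Import all_boot all_order all_algebra.
From mathcomp Require Import classical_sets reals topology normedtype exp.

Set Implicit Arguments.
Unset Strict Implicit.
Unset Printing Implicit Defensive.

Import Order.TTheory GRing.Theory Num.Theory.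
Import numFieldNormedType.Exports.

Local Open Scope ring_scope.

Section Euclidean.
Variables (R : realType) (d : nat).

Definition dot (x y : 'cV[R]_d) : R := \sum_i x i 0 * y i 0.

(* The norm `|x| of MathComp-Analysis on matrices is the max norm, so the
   Euclidean norm needs its own definition. *)
Definition norm2 (x : 'cV[R]_d) : R := Num.sqrt (dot x x).

(* Orthogonal projection of x onto the row space of U: the projection onto U
   parallel to kermx U^T, whose row space is the orthogonal complement of U. *)
Definition orthproj (U : 'M[R]_d) (x : 'cV[R]_d) : 'cV[R]_d :=
  (x^T *m proj_mx U (kermx U^T))^T.

End Euclidean.

Section Walk.
Variables (R : realType) (d n : nat).

(* [n] is represented by 'I_n = {0, .., n-1} with its usual order. *)
Variable v : 'I_n -> 'cV[R]_d.

Definition colmx : 'M[R]_(d, n) := \matrix_(i, j) v j i 0.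

Definition alive (X : 'cV[R]_n) : {set 'I_n} := [set i | `|X i 0| < 1].

(* The largest alive index; None when there is none. *)
Definition pivot (X : 'cV[R]_n) : option 'I_n :=
  [pick p in alive X | [forall j in alive X, (j <= p)%N]].

Definition feasible (A : {set 'I_n}) (p : 'I_n) (u : 'cV[R]_n) : Prop :=
  u p 0 = 1 /\ (forall i, i \notin A -> u i 0 = 0).

(* A rule u choosing, at every position X with an alive coordinate, one of the
   minimizers; X determines both the alive set and the pivot. *)
Definition gsw_rule (u : 'cV[R]_n -> 'cV[R]_n) : Prop :=
  forall (X : 'cV[R]_n) (p : 'I_n), pivot X = Some p ->
    feasible (alive X) p (u X) /\
    (forall u' : 'cV[R]_n, feasible (alive X) p u' ->
       norm2 (colmx *m u X) <= norm2 (colmx *m u')).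

Variable u : 'cV[R]_n -> 'cV[R]_n.

Definition Delta (X : 'cV[R]_n) : set R :=
  [set delta | forall i, `|(X + delta *: u X) i 0| <= 1]%classic.

Definition deltap (X : 'cV[R]_n) : R := `|sup (Delta X)|.
Definition deltam (X : 'cV[R]_n) : R := `|inf (Delta X)|.

(* The coin b = true selects the step delta^+, and b = false selects
   -delta^-. Once no coordinate is alive the position no longer changes. *)
Definition gsw_step (X : 'cV[R]_n) (b : bool) : 'cV[R]_n :=
  if pivot X is Some _ then
    X + (if b then deltap X else - deltam X) *: u X
  else X.

(* Probability of the coin b at position X; coins tossed after the end of the
   walk are fair and have no effect. *)
Definition coin_prob (X : 'cV[R]_n) (b : bool) : R :=
  if pivot X is Some _ then
    (if b then deltam X else deltap X) / (deltam X + deltap X)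
  else 2^-1.

Section Run.

(* The outcome of the run is a sequence of n coins, as there are at most n
   steps; the coin of step t has index t.-1. *)
Variable omega : n.-tuple bool.

Fixpoint walk (k : nat) : 'cV[R]_n :=
  if k is k'.+1 then gsw_step (walk k') (nth true omega k') else 0.

(* Steps are numbered from 1: pos t is X_t, with X_1 = 0. *)
Definition pos (t : nat) : 'cV[R]_n := walk t.-1.

Definition aliveset (t : nat) : {set 'I_n} := alive (pos t).
Definition pivot_at (t : nat) : option 'I_n := pivot (pos t).

Definition frozen (t : nat) : {set 'I_n} := aliveset t :\: aliveset t.+1.

(* T is the first t in 0, .., n such that A_(t+1) is empty. *)
Definition nsteps : nat :=
  find (fun t => aliveset t.+1 == finset.set0) (iota 0 n.+1).

Definition steps_of (p : 'I_n) : seq nat :=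
  [seq t <- iota 1 nsteps | pivot_at t == Some p].

Definition pivots : {set 'I_n} := [set p | steps_of p != [::]].

(* The minimum of steps_of p when p is a pivot (all steps are <= n). *)
Definition first_step (p : 'I_n) : nat := \big[minn/n]_(t <- steps_of p) t.

Definition new_pivot (t : nat) : bool :=
  (t == 1%N) || (pivot_at t != pivot_at t.-1).

Definition order_block (t : nat) : seq 'I_n :=
  (if new_pivot t then seq_of_opt (pivot_at t) else [::]) ++
  rev [seq j <- enum 'I_n | (j \in frozen t) && (Some j != pivot_at t)].

(* sigma(n), sigma(n-1), .., sigma(1) in this order. *)
Definition order_seq : seq 'I_n :=
  flatten [seq order_block t | t <- iota 1 nsteps].

(* Ranks are counted from 0, i.e. sigma r stands for sigma(r+1). The default
   value r of nth is never used, since order_seq enumerates 'I_n. *)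
Definition sigma (r : 'I_n) : 'I_n := nth r (rev order_seq) r.

Definition span_before (r : 'I_n) : 'M[R]_d :=
  (\sum_(k < n | (k < r)%N) <<(v (sigma k))^T>>)%MS.

Definition residual (r : 'I_n) : 'cV[R]_d :=
  v (sigma r) - orthproj (span_before r) (v (sigma r)).

(* The vector w_(sigma(r)). *)
Definition w (r : 'I_n) : 'cV[R]_d :=
  if residual r == 0 then 0 else (norm2 (residual r))^-1 *: residual r.

Definition Q (p : 'I_n) (t : nat) : {set 'I_n} :=
  if t == (first_step p).-1 then [set r | sigma r == p]
  else if t \in steps_of p then
    [set r | (sigma r \in frozen t) && (sigma r != p)]
  else finset.set0.

Definition Z (x : 'cV[R]_d) : R :=
  \sum_(p in pivots)
    (\sum_((first_step p).-1 <= s < n.+1)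
       `|\sum_(r in Q p s) dot (w r) (v p) * dot (w r) x|) ^+ 2.

Definition nontrivial_steps (p : 'I_n) : nat :=
  count (fun t => [exists r in Q p t, w r != 0])
        (index_iota (first_step p).-1 n.+1).

Definition That : nat := (\sum_(p in pivots) nontrivial_steps p)%N.

Definition run_prob : R :=
  \prod_(k < n) coin_prob (walk k) (tnth omega k).

End Run.

Definition expect (f : n.-tuple bool -> R) : R :=
  \sum_(omega : n.-tuple bool) run_prob omega * f omega.

End Walk.

(* Main.v *)
Require Import Defs.
From mathcomp Require Import all_boot all_order all_algebra.
From mathcomp Require Import boolp classical_sets functions reals topology.
From mathcomp Require Import normedtype sequences derive realfun exp.
From mathcomp Require Import zify ring lra.
Set Implicit Arguments.
Unset Strict Implicit.
Unset Printing Implicit Defensive.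
Import Order.TTheory GRing.Theory Num.Theory.
Import numFieldNormedType.Exports.
Local Open Scope ring_scope.

(** While an index [p] is pivot, [M *m u] is what remains of [v p] after
    projection onto the span of the other unfrozen vectors ([rule_leftover]):
    any feasible value differs from this leftover by a vector of the span, so
    Pythagoras singles out the minimizer. The order of the indices is such
    that at each step the unfrozen indices other than the pivot have the
    lowest ranks ([lowest_alive_step], [lowest_alive_next]). The projections
    hence expand in the vectors [w], and the inner sums in [Z] are the
    increments, from one step to the next, of the inner product of the
    leftover with the fixed vector ([leftover_first], [leftover_step]).

    Fix a vector [x] and let [D] be the inner product of [x] with the output
    of the walk. The key estimate is that
    [expR (lam * D - lam ^+ 2 / 2 * Z x)] has expectation at most [1]
    ([expect_expR_le1]). If the leftover never changed during the life of a
    pivot, the contribution of this pivot would be that of a centred sign,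
    whose moment generating function [psi] is sub-Gaussian. Let [b] be [lam]
    times the inner product of the leftover with [x]. A change of [b] by [a]
    multiplies [psi] by at most [expR (|b| * |a| + a ^+ 2 / 2)]
    ([psi_shift]); as [|b|] is at most its own total variation so far, this
    factor is paid for by the increase of half the square of the total
    variation, and [Z x] sums these squares over the pivots. The resulting
    [potential] is a supermartingale ([potential_supermartingale]).

    Each vector [w] belongs to a single block [Q p s] ([Q_disjoint]), so
    Cauchy-Schwarz and Bessel's inequality give [Z x <= |x| ^+ 2] ([Z_le]),
    the bound on [That] ([That_le]), and, with the squared lengths of the
    blocks as weights, [\sum_i Z (e_i) <= That] ([sum_Z_le]).

    For the signs, suppose that each run has a coordinate of absolute value
    above [B]. With [s = lam ^+ 2 / 2], the key estimate for [lam] and [- lam]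
    bounds the expectation of
    [\sum_i expR (- s * Z (e_i)) * (cosh (lam * D_i) - 1)] by
    [\sum_i E (1 - expR (- s * Z (e_i)))], hence by [s * E That]
    ([expect_sum_cosh_le]): subtracting [1] is what makes [That] appear
    instead of the dimension. The same expectation is at least
    [(cosh (lam * B) - 1) * expR (- s * E (max_i Z (e_i)))] by Jensen's
    inequality, and a suitable [lam] makes the two bounds contradictory
    ([exists_small_disc]). *)

(** * Orthogonal projections *)
Section EuclideanTheory.
Variables (R : realType) (d : nat).
Implicit Types (x y z : 'cV[R]_d) (U V : 'M[R]_d).

Lemma dotE x y : dot x y = (x^T *m y) 0 0.
Proof. by rewrite mxE; apply: eq_bigr => i _; rewrite mxE. Qed.

Lemma dotC x y : dot x y = dot y x.
Proof. by apply: eq_bigr => i _; rewrite mulrC. Qed.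

Lemma dotDl x y z : dot (x + y) z = dot x z + dot y z.
Proof. by rewrite /dot -big_split; apply: eq_bigr => i _; rewrite mxE mulrDl. Qed.

Lemma dotZl a x z : dot (a *: x) z = a * dot x z.
Proof. by rewrite /dot mulr_sumr; apply: eq_bigr => i _; rewrite mxE mulrA. Qed.

Lemma dotNl x z : dot (- x) z = - dot x z.
Proof. by rewrite -scaleN1r dotZl mulN1r. Qed.

Lemma dotBl x y z : dot (x - y) z = dot x z - dot y z.
Proof. by rewrite dotDl dotNl. Qed.

Lemma dot0l z : dot 0 z = 0.
Proof. by rewrite -(scale0r 0) dotZl mul0r. Qed.

Lemma dotDr z x y : dot z (x + y) = dot z x + dot z y.
Proof. by rewrite dotC dotDl !(dotC _ z). Qed.

Lemma dotZr a z x : dot z (a *: x) = a * dot z x.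
Proof. by rewrite dotC dotZl dotC. Qed.

Lemma dotBr z x y : dot z (x - y) = dot z x - dot z y.
Proof. by rewrite dotC dotBl !(dotC _ z). Qed.

Lemma dot0r z : dot z 0 = 0.
Proof. by rewrite dotC dot0l. Qed.

Lemma dot_suml I (r : seq I) (P : pred I) (F : I -> 'cV[R]_d) z :
  dot (\sum_(i <- r | P i) F i) z = \sum_(i <- r | P i) dot (F i) z.
Proof.
by apply: (big_morph (fun y => dot y z)) => [x y|]; rewrite ?dotDl ?dot0l.
Qed.

Lemma dot_sumr I (r : seq I) (P : pred I) (F : I -> 'cV[R]_d) z :
  dot z (\sum_(i <- r | P i) F i) = \sum_(i <- r | P i) dot z (F i).
Proof. by rewrite dotC dot_suml; apply: eq_bigr => i _; rewrite dotC. Qed.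

Lemma dot_delta x (i : 'I_d) : dot x (delta_mx i 0) = x i 0.
Proof.
rewrite /dot (bigD1 i) //= mxE !eqxx mulr1 big1 ?addr0 // => j ji.
by rewrite mxE (negbTE ji) mulr0.
Qed.

Lemma dot_ge0 x : 0 <= dot x x.
Proof. by apply: sumr_ge0 => i _; rewrite -expr2 sqr_ge0. Qed.

Lemma dot_eq0 x : (dot x x == 0) = (x == 0).
Proof.
apply/eqP/eqP => [/eqP|->]; last by rewrite dot0l.
rewrite psumr_eq0 => [/allP xx0|i _]; last by rewrite -expr2 sqr_ge0.
apply/matrixP => i j; rewrite mxE (ord1 j); apply/eqP.
by have := xx0 i (mem_index_enum i); rewrite /= mulf_eq0 orbb.
Qed.

Lemma dot_pythagoras x y : dot x y = 0 ->
  dot (x + y) (x + y) = dot x x + dot y y.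
Proof. by move=> xy; rewrite dotDl !dotDr (dotC y) xy addr0 add0r. Qed.

Lemma norm2_sqr x : norm2 x ^+ 2 = dot x x.
Proof. by rewrite sqr_sqrtr // dot_ge0. Qed.

Lemma norm2_le x y : (norm2 x <= norm2 y) = (dot x x <= dot y y).
Proof. by rewrite ler_sqrt // dot_ge0. Qed.

Lemma norm2_eq0 x : (norm2 x == 0) = (x == 0).
Proof. by rewrite -dot_eq0 -norm2_sqr expf_eq0. Qed.

Lemma submx_ker_orth U y :
  (y^T <= kermx U^T)%MS <-> (forall z, (z^T <= U)%MS -> dot y z = 0).
Proof.
split=> [/sub_kermxP yU z /submxP[t zE]|yU].
  by rewrite dotE -(trmxK z) zE trmx_mul mulmxA yU mul0mx mxE.
apply/sub_kermxP/rowP => i; rewrite !mxE.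
have := yU (row i U)^T; rewrite trmxK row_sub => /(_ isT) yUi.
by rewrite -[RHS]yUi /dot; apply: eq_bigr => j _; rewrite !mxE.
Qed.

Lemma capmx_ker_tr U : (U :&: kermx U^T)%MS = 0.
Proof.
apply/eqP/rowV0P => r; rewrite sub_capmx -{2}(trmxK r) => /andP[rU] /submx_ker_orth.
move=> /(_ r^T); rewrite trmxK => /(_ rU)/eqP; rewrite dot_eq0 => /eqP r0.
by rewrite -(trmxK r) r0 trmx0.
Qed.

Lemma addsmx_ker_tr_full U (r : 'rV[R]_d) : (r <= U + kermx U^T)%MS.
Proof.
apply: submx_full; rewrite /row_full (mxrank_disjoint_sum (capmx_ker_tr U)).
by rewrite mxrank_ker mxrank_tr subnKC // rank_leq_col.
Qed.

Lemma orthproj_sub U y : ((orthproj U y)^T <= U)%MS.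
Proof. by rewrite trmxK proj_mx_sub. Qed.

Lemma orthproj_orth U y z : (z^T <= U)%MS -> dot (y - orthproj U y) z = 0.
Proof.
move: z; apply/submx_ker_orth; rewrite linearB /= trmxK.
exact: proj_mx_compl_sub (addsmx_ker_tr_full _ _).
Qed.

(** Projections are computed through this lemma, by exhibiting a point of the
    subspace whose difference with [y] is orthogonal to it. *)
Lemma orthproj_uniq U y z : (z^T <= U)%MS ->
  (forall z', (z'^T <= U)%MS -> dot (y - z) z' = 0) -> orthproj U y = z.
Proof.
move=> zU yz; apply/eqP; rewrite -subr_eq0 -dot_eq0.
have pzU : ((orthproj U y - z)^T <= U)%MS.
  by rewrite linearB addmx_sub ?orthproj_sub // eqmx_opp.
have pzE : (y - z) - (y - orthproj U y) = orthproj U y - z.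
  by rewrite opprB [LHS]addrC addrA subrK.
by rewrite -[X in dot X _]pzE dotBl yz // orthproj_orth // subr0.
Qed.

Lemma orthproj_id U y : (y^T <= U)%MS -> orthproj U y = y.
Proof. by move=> yU; apply: orthproj_uniq => // z _; rewrite subrr dot0l. Qed.

Lemma dot_orthproj_le U y : dot (orthproj U y) y <= dot y y.
Proof.
have o := orthproj_orth y (orthproj_sub U y).
have := dot_ge0 (y - orthproj U y).
rewrite dotBr o subr0 dotBl (dotC (orthproj U y)); lra.
Qed.

End EuclideanTheory.

Section Spans.
Variables (R : realType) (d n : nat) (v : 'I_n -> 'cV[R]_d).

Definition spanmx (S : {set 'I_n}) : 'M[R]_d :=
  (\sum_(j in S) <<(v j)^T>>)%MS.

Lemma spanmx_gen (S : {set 'I_n}) j : j \in S -> ((v j)^T <= spanmx S)%MS.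
Proof. by move=> jS; rewrite (sumsmx_sup j) // genmxE. Qed.

Lemma spanmx_orth (S : {set 'I_n}) y :
  (forall j, j \in S -> dot y (v j) = 0) ->
  forall z, (z^T <= spanmx S)%MS -> dot y z = 0.
Proof.
move=> yS; apply/submx_ker_orth.
suff : (spanmx S <= kermx y)%MS.
  move=> /sub_kermxP Sy; apply/sub_kermxP.
  by rewrite -trmx_mul Sy trmx0.
apply/sumsmx_subP => j jS; rewrite genmxE; apply/sub_kermxP/matrixP => i k.
by rewrite !ord1 -dotE dotC yS // mxE.
Qed.

Lemma spanmx_comb (S : {set 'I_n}) z : (z^T <= spanmx S)%MS ->
  exists2 c : 'I_n -> R, (forall i, i \notin S -> c i = 0)
    & z = \sum_i c i *: v i.
Proof.
move=> /sub_sumsmxP[c_ zE].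
have cP j : exists a : R, (c_ j *m <<(v j)^T>>%MS) = a *: (v j)^T.
  have /sub_rVP[a aE] : (c_ j *m <<(v j)^T>>%MS <= (v j)^T)%MS.
    by rewrite (submx_trans (submxMl _ _)) // genmxE.
  by exists a.
have [a aE] := fin_all_exists cP.
exists (fun i => if i \in S then a i else 0) => [i /negbTE -> //|].
rewrite -(trmxK z) zE linear_sum /= (big_mkcond (mem S)) /=.
apply: eq_bigr => i _; case: ifP => _; last by rewrite scale0r.
by rewrite aE linearZ /= trmxK.
Qed.

End Spans.

(** * One step of the walk *)
Section Step.
Variables (R : realType) (d n : nat) (v : 'I_n -> 'cV[R]_d).
Implicit Types (X ux : 'cV[R]_n).

Definition in_cube X := forall i, `|X i 0| <= 1.

Lemma in_alive X i : (i \in alive X) = (`|X i 0| < 1).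
Proof. by rewrite inE. Qed.

Lemma pivotP X p : pivot X = Some p <->
  p \in alive X /\ (forall j, j \in alive X -> (j <= p)%N).
Proof.
rewrite /pivot; case: pickP => [q /andP[qX /forall_inP qmax]|none]; split.
- by case=> <-.
- case=> pX pmax; congr Some; apply/val_inj/eqP.
  by rewrite eqn_leq pmax //= qmax.
- by [].
- case=> pX pmax; have := none p; rewrite pX /=.
  by move/negP; case; apply/forall_inP.
Qed.

Lemma pivot_None X : pivot X = None <-> alive X = finset.set0.
Proof.
split=> [Xnone|X0]; last first.
  by case pX: (pivot X) => [p|//]; have /pivotP[] := pX; rewrite X0 inE.
apply/eqP; apply: contraT => /set0Pn[i0 i0X].
case: (arg_maxnP (fun j : 'I_n => val j) i0X) => p pX pmax.
by have /pivotP : p \in alive X /\ (forall j, j \in alive X -> (j <= p)%N)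
  by []; rewrite Xnone.
Qed.

Lemma colmx_mulE X : colmx v *m X = \sum_j X j 0 *: v j.
Proof.
apply/matrixP => i k; rewrite (ord1 k) summxE mxE.
by apply: eq_bigr => j _; rewrite !mxE mulrC.
Qed.

(** Along a direction that moves some unfrozen coordinate, the first face of
    the cube that is hit determines the largest admissible step. *)
Lemma max_step X ux p : in_cube X -> p \in alive X -> ux p 0 != 0 ->
  (forall i, i \notin alive X -> ux i 0 = 0) ->
  exists delta, [/\ 0 < delta, in_cube (X + delta *: ux),
    exists2 i, i \in alive X & `|(X + delta *: ux) i 0| = 1
    & forall e, in_cube (X + e *: ux) -> e <= delta].
Proof.
move=> cX pX up suppu.
pose f i := if 0 < ux i 0 then (1 - X i 0) / ux i 0
            else (1 + X i 0) / (- ux i 0).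
have aliveP i : ux i 0 != 0 -> i \in alive X.
  by apply: contraR => /suppu ->.
case: (Order.TotalTheory.arg_minP f (up : (fun i => ux i 0 != 0) p)) =>
  i0 ui0 f_min.
have fE i : ux i 0 != 0 ->
    (0 < ux i 0 /\ f i * ux i 0 = 1 - X i 0) \/
    (ux i 0 < 0 /\ f i * ux i 0 = - (1 + X i 0)).
  rewrite /f => ui; case: ltP => [u0|u0]; first by left; rewrite divfK.
  by right; split; [rewrite lt_neqAle ui|rewrite invrN mulrN mulNr divfK].
exists (f i0); split.
- have := aliveP _ ui0; rewrite in_alive ltr_norml => /andP[Xl Xu].
  by case: (fE _ ui0) => -[us fu]; nra.
- move=> i; rewrite !mxE ler_norml.
  have := cX i; rewrite ler_norml => /andP[Xl Xu].
  case: (eqVneq (ux i 0) 0) => [->|ui]; first by rewrite mulr0 addr0 Xl.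
  have fi := f_min _ ui.
  have fp : 0 <= f i0.
    have := aliveP _ ui0; rewrite in_alive ltr_norml => /andP[Xl' Xu'].
    by case: (fE _ ui0) => -[us fu]; nra.
  by case: (fE _ ui) => -[us fu]; apply/andP; split; nra.
- exists i0; first exact: aliveP.
  rewrite !mxE; case: (fE _ ui0) => -[us ->].
    by rewrite addrC subrK normr1.
  by rewrite opprD addrCA subrr addr0 normrN normr1.
- move=> e /(_ i0); rewrite !mxE ler_norml => /andP[el eu].
  by case: (fE _ ui0) => -[us fu]; nra.
Qed.

Variable u : 'cV[R]_n -> 'cV[R]_n.
Hypothesis hu : gsw_rule v u.

Lemma rule_pivot X p : pivot X = Some p -> u X p 0 = 1.
Proof. by case/hu => -[]. Qed.

Lemma rule_supp X p i : pivot X = Some p -> i \notin alive X -> u X i 0 = 0.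
Proof. by move=> pX iX; have [[_ us] _] := hu pX; apply: us. Qed.

Lemma sup_max (A : set R) a : A a -> (forall b, A b -> b <= a) -> sup A = a.
Proof.
move=> Aa ubA; apply/eqP; rewrite eq_le; apply/andP; split.
  by apply: ge_sup => //; exists a.
by apply: ub_le_sup => //; exists a.
Qed.

Lemma inf_min (A : set R) a : A a -> (forall b, A b -> a <= b) -> inf A = a.
Proof.
move=> Aa lbA; apply/eqP; rewrite eq_le; apply/andP; split.
  by apply: ge_inf => //; exists a.
by apply: lb_le_inf => //; exists a.
Qed.

Lemma deltapP X p : in_cube X -> pivot X = Some p ->
  [/\ 0 < deltap u X, in_cube (X + deltap u X *: u X) &
   exists2 i, i \in alive X & `|(X + deltap u X *: u X) i 0| = 1].
Proof.
move=> cX pX; have /pivotP[pA _] := pX.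
have up : u X p 0 != 0 by rewrite (rule_pivot pX) oner_eq0.
have [e [e0 ce hit emax]] := max_step cX pA up (fun i => rule_supp pX).
suff -> : deltap u X = e by [].
by rewrite /deltap (@sup_max _ e) ?gtr0_norm.
Qed.

Lemma deltamP X p : in_cube X -> pivot X = Some p ->
  [/\ 0 < deltam u X, in_cube (X + (- deltam u X) *: u X) &
   exists2 i, i \in alive X & `|(X + (- deltam u X) *: u X) i 0| = 1].
Proof.
move=> cX pX; have /pivotP[pA _] := pX.
have up : (- u X) p 0 != 0 by rewrite mxE oppr_eq0 (rule_pivot pX) oner_eq0.
have us i : i \notin alive X -> (- u X) i 0 = 0.
  by move=> iA; rewrite mxE (rule_supp pX iA) oppr0.
have [e [e0 ce hit emax]] := max_step cX pA up us.
have flip a : a *: - u X = (- a) *: u X by rewrite scalerN scaleNr.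
suff -> : deltam u X = e by rewrite -flip.
rewrite /deltam (@inf_min _ (- e)) ?normrN ?gtr0_norm //.
  by move=> i; rewrite -flip.
move=> b cb; rewrite lerNl; apply: emax => i.
by rewrite flip opprK.
Qed.

Lemma gsw_stepE X p b : pivot X = Some p ->
  gsw_step u X b = X + (if b then deltap u X else - deltam u X) *: u X.
Proof. by rewrite /gsw_step => ->. Qed.

Lemma gsw_step_cube X b : in_cube X -> in_cube (gsw_step u X b).
Proof.
move=> cX; case pX: (pivot X) => [p|]; last by rewrite /gsw_step pX.
rewrite (gsw_stepE _ pX); case: b.
  by have [] := deltapP cX pX.
by have [] := deltamP cX pX.
Qed.

Lemma gsw_step_alive X b : alive (gsw_step u X b) \subset alive X.
Proof.
case pX: (pivot X) => [p|]; last by rewrite /gsw_step pX.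
apply/fintype.subsetP => i; apply: contraTT => iX.
by rewrite in_alive (gsw_stepE _ pX) !mxE (rule_supp pX iX) mulr0 addr0 -in_alive.
Qed.

Lemma gsw_step_alive_proper X p b : in_cube X -> pivot X = Some p ->
  alive (gsw_step u X b) \proper alive X.
Proof.
move=> cX pX; rewrite properE gsw_step_alive /=; apply/fintype.subsetPn.
rewrite (gsw_stepE _ pX).
have [i iX hit] : exists2 i, i \in alive X
    & `|(X + (if b then deltap u X else - deltam u X) *: u X) i 0| = 1.
  case: b; first by have [] := deltapP cX pX.
  by have [] := deltamP cX pX.
by exists i => //; rewrite in_alive hit ltxx.
Qed.

Lemma pivot_sub X (Y : 'cV[R]_n) p : pivot X = Some p -> alive Y \subset alive X ->
  p \in alive Y -> pivot Y = Some p.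
Proof.
move=> /pivotP[_ pmax] /fintype.subsetP sYX pY.
by apply/pivotP; split=> // j /sYX/pmax.
Qed.

(** This is defined at every position, whether or not [p] is still unfrozen
    there: the last block of a pivot compares its leftovers before and after
    the step that freezes it. *)
Definition leftover X p : 'cV[R]_d :=
  v p - orthproj (spanmx v (alive X :\ p)) (v p).

(** The residual of the projection is attained by a feasible vector, and by
    Pythagoras any other feasible value is strictly longer. *)
Lemma rule_leftover X p : pivot X = Some p -> colmx v *m u X = leftover X p.
Proof.
move=> pX; set V := spanmx v (alive X :\ p); have /pivotP[pA _] := pX.
set P := orthproj V (v p).
have PV : (P^T <= V)%MS by apply: orthproj_sub.
have orth z : (z^T <= V)%MS -> dot (leftover X p) z = 0 by apply: orthproj_orth.
have [c c0 Pc] := spanmx_comb PV.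
pose u' : 'cV[R]_n := \col_i ((i == p)%:R - c i).
have fu' : feasible (alive X) p u'.
  split=> [|i iX]; first by rewrite mxE eqxx c0 ?subr0 // !inE eqxx.
  rewrite mxE c0 ?subr0; first by case: eqP iX => // ->; rewrite pA.
  by rewrite in_setD1 negb_and iX orbT.
have Mu' : colmx v *m u' = leftover X p.
  rewrite colmx_mulE /leftover -/V -/P Pc.
  have vpE : v p = \sum_i (i == p)%:R *: v i.
    rewrite (bigD1 p) //= eqxx scale1r big1 ?addr0 // => j /negbTE->.
    by rewrite scale0r.
  rewrite {1}vpE.
  by rewrite -sumrB; apply: eq_bigr => i _; rewrite mxE scalerBl.
have [_ /(_ u' fu')] := hu pX; rewrite norm2_le Mu'.
set s := colmx v *m u X - leftover X p.
have sV : (s^T <= V)%MS.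
  rewrite /s colmx_mulE (bigD1 p) //= (rule_pivot pX) scale1r /leftover.
  rewrite opprB [X in X^T]addrC addrA subrK.
  rewrite linearD /= addmx_sub // linear_sum /=.
  apply: summx_sub => j jp; rewrite linearZ /=.
  case jX: (j \in alive X); last first.
    by rewrite (rule_supp pX) ?jX // scale0r sub0mx.
  by apply: scalemx_sub; apply: spanmx_gen; rewrite in_setD1 jp jX.
have -> : colmx v *m u X = leftover X p + s by rewrite addrC subrK.
rewrite (dot_pythagoras (orth _ sV)) gerDl => ss.
have /eqP : dot s s == 0 by rewrite eq_le ss dot_ge0.
by move/eqP; rewrite dot_eq0 => /eqP->; rewrite addr0.
Qed.

End Step.

(** * The moment generating function of a centred sign *)
Section Bernoulli.
Variable R : realType.
Implicit Types x y a b h m : R.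

Lemma is_derive_ge0_le (f df : R -> R) a :
  (forall t : R, is_derive t 1 f (df t)) -> (forall t, 0 <= t -> 0 <= df t) ->
  0 <= a -> f 0 <= f a.
Proof.
move=> fdf df0 a0.
have cf : continuous f.
  move=> t; apply/differentiable_continuous/derivable1_diffP.
  by have [] := fdf t.
have [|c cI fE] := MVT_segment a0 (fun t _ => fdf t).
  exact: continuous_subspaceT.
rewrite -subr_ge0 fE; apply: mulr_ge0; rewrite ?subr0 //.
by apply: df0; move: cI; rewrite in_itv => /andP[].
Qed.

Lemma is_derive_expR_comp (g : R -> R) x (dg : R) :
  is_derive x 1 g dg -> is_derive x 1 (fun t => expR (g t)) (dg * expR (g x)).
Proof.
by move=> gd; have := is_derive1_comp (is_derive_expR (g x)) gd; rewrite mulrC.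
Qed.

Lemma expR_diff_le h : 0 <= h ->
  expR h - expR (- h) <= h * (expR h + expR (- h)).
Proof.
move=> h0; rewrite -subr_ge0.
pose f t : R := t * (expR t + expR (- t)) - (expR t - expR (- t)).
pose df t : R := t * (expR t - expR (- t)).
have fdf (t : R) : is_derive t 1 f (df t).
  pose en (y : R) : R := expR (- y).
  have dN : is_derive t (1 : R) en (- 1 * expR (- t)).
    by apply: is_derive_expR_comp; apply: is_deriveNid.
  have -> : f = ((id : R -> R) * ((expR : R -> R) + en) - ((expR : R -> R) - en)) by [].

  apply: is_derive_eq; rewrite /df /GRing.scale /=.
  have -> : (expR + en) t = expR t + expR (- t) by [].
  ring.
have := is_derive_ge0_le fdf _ h0; rewrite /f mul0r oppr0 subrr subr0.
apply=> t t0; rewrite mulr_ge0 // subr_ge0 ler_expR; lra.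
Qed.

(** The expectation of [expR (y * (eps - x))] for a random sign [eps] of mean
    [x]. *)
Definition psi x y : R :=
  (1 + x) / 2 * expR ((1 - x) * y) + (1 - x) / 2 * expR (- (1 + x) * y).

Lemma psi0 x : psi x 0 = 1.
Proof. by rewrite /psi !mulr0 expR0; field. Qed.

Lemma psi_sign x y : `|x| = 1 -> psi x y = 1.
Proof.
move=> x1; have [->|->] : x = 1 \/ x = -1.
- by case: (leP 0 x) x1 => x0; [rewrite ger0_norm|rewrite ltr0_norm] => //;
    [left|right; lra].
- by rewrite /psi subrr !mul0r expR0; field.
- by rewrite /psi subrr oppr0 !mul0r expR0; field.
Qed.

Lemma psi_ge0 x y : `|x| <= 1 -> 0 <= psi x y.
Proof.
rewrite ler_norml => /andP[xl xu].
by rewrite addr_ge0 // mulr_ge0 ?expR_ge0 //; lra.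
Qed.

Lemma psi_opp x y : psi (- x) (- y) = psi x y.
Proof.
rewrite /psi addrC; congr (_ * expR _ + _ * expR _); ring.
Qed.

(** Since [expR (x * y) * psi x y] is affine in [x], a centred move of [x]
    preserves its expectation: the potential of the walk is a martingale as
    long as the leftover does not change. *)
Lemma psi_affine x y : psi x y =
  expR (- (x * y)) * ((1 + x) / 2 * expR y + (1 - x) / 2 * expR (- y)).
Proof.
rewrite mulrDr !(mulrCA (expR _)) -!expRD /psi.
by congr (_ * expR _ + _ * expR _); ring.
Qed.

(** With [s] and [c] twice the hyperbolic sine and cosine of [y / 2], the
    bound [s <= y / 2 * c] reduces the claim to [0 <= s * (s + x * c) ^+ 2]. *)
Lemma psi_derive_le x y : `|x| <= 1 -> 0 <= y ->
  (1 - x ^+ 2) / 2 * (expR y - expR (- y)) <=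
  y * ((1 + x) / 2 * expR y + (1 - x) / 2 * expR (- y)).
Proof.
rewrite ler_norml => /andP[xl xu] y0.
have h0 : 0 <= y / 2 by lra.
have := expR_diff_le h0; set h := y / 2 in h0 *.
have yE : y = h + h by rewrite /h; field.
rewrite yE opprD !expRD; have := expR_gt0 h; have := expR_gt0 (- h).
have : expR (- h) <= expR h by rewrite ler_expR; lra.
move: (expR h) (expR (- h)) => p q qp q0 p0 sc.
have c0 : 0 < p + q by lra.
have s0 : 0 <= p - q by lra.
rewrite -subr_ge0 -(pmulr_rge0 _ c0).
have -> : (p + q) * ((h + h) * ((1 + x) / 2 * (p * p) + (1 - x) / 2 * (q * q))
    - (1 - x ^+ 2) / 2 * (p * p - q * q))
  = (h * (p + q) - (p - q)) * ((1 + x) * (p * p) + (1 - x) * (q * q))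
    + (p - q) / 2 * ((p - q) + x * (p + q)) ^+ 2 by field.
apply: addr_ge0; apply: mulr_ge0; rewrite ?sqr_ge0 //; try lra.
by rewrite addr_ge0 // mulr_ge0 //; [lra|nra|lra|nra].
Qed.

Let dpsi x y := (1 - x ^+ 2) / 2 * (expR ((1 - x) * y) - expR (- (1 + x) * y)).

Let dpsi_le x y : `|x| <= 1 -> dpsi x y <= `|y| * psi x y.
Proof.
move=> x1; have x2 : 0 <= (1 - x ^+ 2) / 2.
  by move: x1; rewrite ler_norml => /andP[xl xu]; nra.
have dE : dpsi x y =
    expR (- (x * y)) * ((1 - x ^+ 2) / 2 * (expR y - expR (- y))).
  rewrite /dpsi mulrCA; congr (_ * _); rewrite mulrBr -!expRD.
  by congr (expR _ - expR _); ring.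
have [y0|y0] := leP 0 y.
  rewrite dE psi_affine (ger0_norm y0) (mulrCA y) ler_pM2l ?expR_gt0 //.
  exact: psi_derive_le.
apply: (@le_trans _ _ 0); last by rewrite mulr_ge0 ?psi_ge0.
rewrite /dpsi mulr_ge0_le0 // subr_le0 ler_expR; lra.
Qed.

Let psi_shift_ge0 x b a : `|x| <= 1 -> 0 <= a ->
  psi x (b + a) <= psi x b * expR (`|b| * a + a ^+ 2 / 2).
Proof.
move=> x1 a0; set beta := `|b|.
pose E (k t : R) : R := expR (k * (b + t) - (beta * t + t ^+ 2 / 2)).
pose f t : R := - ((1 + x) / 2 * E (1 - x) t + (1 - x) / 2 * E (- (1 + x)) t).
pose dE (k t : R) : R := (k - (beta + t)) * E k t.
have dEP k (t : R) : is_derive t (1 : R) (E k) (dE k t).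
  rewrite /E /dE; apply: is_derive_expR_comp.
  have -> : (fun t => k * (b + t) - (beta * t + t ^+ 2 / 2)) =
    (k *: (cst b + (id : R -> R)) -
      (beta *: (id : R -> R) + 2^-1 *: ((id : R -> R) * (id : R -> R))) : R -> R).
    apply/boolp.funext => s.
    have -> : s ^+ 2 / 2 = 2^-1 * (s * s) by rewrite mulrC expr2.
    by [].
  by apply: is_derive_eq; rewrite /GRing.scale /=; field.
pose df (t : R) : R := - ((1 + x) / 2 * dE (1 - x) t + (1 - x) / 2 * dE (- (1 + x)) t).
have fdf (t : R) : is_derive t (1 : R) f (df t).
  have -> : f = (- (((1 + x) / 2) *: E (1 - x) + ((1 - x) / 2) *: E (- (1 + x)))
    : R -> R) by [].
  by apply: is_derive_eq.
have EE k t : E k t = expR (k * (b + t)) * expR (- (beta * t + t ^+ 2 / 2)).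
  by rewrite -expRD.
have fE t : f t = - (psi x (b + t) * expR (- (beta * t + t ^+ 2 / 2))).
  by rewrite /f !EE /psi; ring.
have := is_derive_ge0_le fdf _ a0; rewrite !fE lerN2 addr0 mulr0 expr0n /=.
rewrite mul0r addr0 oppr0 expR0 mulr1 expRN ler_pdivrMr ?expR_gt0 //; apply.
move=> t t0.
have -> : df t = ((beta + t) * psi x (b + t) - dpsi x (b + t))
    * expR (- (beta * t + t ^+ 2 / 2)).
  by rewrite /df /dE !EE /psi /dpsi; field.
rewrite mulr_ge0 ?expR_ge0 // subr_ge0 (le_trans (dpsi_le _ x1)) //.
by rewrite ler_wpM2r ?psi_ge0 // (le_trans (ler_normD _ _)) // lerD2l ger0_norm.
Qed.

(** The logarithmic derivative of [psi x] at [y] is at most [|y|], as it would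
    be for a Gaussian of unit variance; integrating it from [b] to [b + a]
    gives the exponent. At [b = 0] this is Hoeffding's lemma. *)
Lemma psi_shift x b a : `|x| <= 1 ->
  psi x (b + a) <= psi x b * expR (`|b| * `|a| + a ^+ 2 / 2).
Proof.
move=> x1; have [a0|a0] := leP 0 a.
  by rewrite (ger0_norm a0) psi_shift_ge0.
rewrite -psi_opp -(psi_opp x b) opprD (ltr0_norm a0) -sqrrN -(normrN b).
by rewrite psi_shift_ge0 ?normrN // oppr_ge0 ltW.
Qed.

Lemma psi_le x b : `|x| <= 1 -> psi x b <= expR (b ^+ 2 / 2).
Proof.
by move=> x1; have := psi_shift 0 b x1; rewrite add0r psi0 normr0 !(mul0r,add0r,mul1r).
Qed.

(** With [e := expR L] the right-hand side is
    [(e ^+ 4 - 1) ^+ 2 / (2 * e ^+ 4)], so that the claim reduces to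
    [2 * L + e ^- 3 < e]. *)
Lemma expR_growth (L : R) : 0 < L ->
  2 * L ^+ 2 * expR (L + L) < (expR (4 * L) + expR (- (4 * L))) / 2 - 1.
Proof.
move=> L0.
have e3 : (1 + L / 3) ^+ 3 <= expR L.
  have -> : expR L = expR (L / 3) ^+ 3.
    by rewrite -expRM_natl; congr expR; field.
  apply: lerXn2r; rewrite ?nnegrE ?expR_ge0 ?expR_ge1Dx //.
  by rewrite addr_ge0 // divr_ge0 // ltW.
have e3L : 1 + 3 * L <= expR (3 * L) by apply: expR_ge1Dx.
set e := expR L in e3 *.
have e0 : 0 < e by apply: expR_gt0.
have E3 : expR (3 * L) = e ^+ 3 by rewrite -expRM_natl.
have E4 : expR (4 * L) = e ^+ 4 by rewrite -expRM_natl.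
rewrite expRN E4 expRD -/e; rewrite E3 in e3L.
have main : 2 * L * e ^+ 3 < e ^+ 4 - 1.
  have : 2 * L + e^-1 ^+ 3 < e; last first.
    rewrite -(ltr_pM2r (exprn_gt0 3 e0)) mulrDl -exprMn mulVf ?gt_eqF // expr1n.
    by rewrite -exprS; lra.
  apply: lt_le_trans e3; rewrite -ltrBrDl exprVn.
  have p3 : 0 < 1 + 3 * L by lra.
  apply: (@le_lt_trans _ _ (1 + 3 * L)^-1); first by rewrite lef_pV2 // posrE ?exprn_gt0.
  rewrite -[X in X < _]mul1r ltr_pdivrMr //.
  rewrite -subr_gt0.
  have -> : ((1 + L / 3) ^+ 3 - 2 * L) * (1 + 3 * L) - 1 =
      L * (28 / 27 * (L - 9 / 7) ^+ 2 + 2 / 7 + L ^+ 3 / 9) by field.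
  have := sqr_ge0 (L - 9 / 7); have := exprn_ge0 3 (ltW L0).
  by move=> L3 L2; rewrite mulr_gt0 //; lra.
have e4 : 0 < e ^+ 4 by apply: exprn_gt0.
have -> : (e ^+ 4 + (e ^+ 4)^-1) / 2 - 1 = (e ^+ 4 - 1) ^+ 2 / (2 * e ^+ 4).
  by field; rewrite gt_eqF.
rewrite ltr_pdivlMr; last lra.
have -> : 2 * L ^+ 2 * (e * e) * (2 * e ^+ 4) = (2 * L * e ^+ 3) ^+ 2 by ring.
have Le0 : 0 <= 2 * L * e ^+ 3 by rewrite !mulr_ge0 ?exprn_ge0 ?ltW.
by rewrite ltr_pXn2r ?nnegrE //; apply: le_trans Le0 (ltW main).
Qed.

End Bernoulli.

(** * Pivots and the order of freezing *)
Section RunTheory.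
Variables (R : realType) (d n : nat) (v : 'I_n -> 'cV[R]_d).
Variable u : 'cV[R]_n -> 'cV[R]_n.
Hypothesis hu : gsw_rule v u.
Variable omega : n.-tuple bool.

Local Notation W := (walk u omega).
Local Notation T := (nsteps u omega).

Lemma walk_cube k : in_cube (W k).
Proof.
elim: k => [|k IH] /=; last exact: (gsw_step_cube hu).
by move=> i; rewrite mxE normr0 ler01.
Qed.

Lemma alive_walk_sub j k : (j <= k)%N -> alive (W k) \subset alive (W j).
Proof.
move=> /subnK <-; elim: (k - j)%N => [|m IH] //=.
exact: fintype.subset_trans (gsw_step_alive hu _ _) IH.
Qed.

(** Every step freezes a coordinate, so the walk is over after [n] steps. *)
Lemma card_alive_walk k : (#|alive (W k)| <= n - k)%N.
Proof.
elim: k => [|k IH]; first by rewrite subn0 -[leqRHS]card_ord max_card.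
case pk: (pivot (W k)) => [p|].
  have := proper_card (gsw_step_alive_proper hu (nth true omega k)
                         (walk_cube k) pk).
  by move=> /leq_trans /(_ IH); rewrite subnS; case: (n - k)%N.
by rewrite /= /gsw_step pk; move/pivot_None: pk => ->; rewrite cards0.
Qed.

Lemma alive_walk_end : alive (W n) = finset.set0.
Proof. by apply/eqP; rewrite -cards_eq0 -leqn0 -(subnn n) card_alive_walk. Qed.

Lemma nsteps_spec : (T <= n)%N /\ alive (W T) = finset.set0.
Proof.
have hasT : has (fun t => aliveset u omega t.+1 == finset.set0) (iota 0 n.+1).
  apply/hasP; exists n; first by rewrite mem_iota /= add0n ltnS.
  by rewrite /aliveset /pos /= alive_walk_end.
have := hasT; rewrite has_find size_iota -/(nsteps u omega) ltnS => Tn.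
split=> //; have /eqP := nth_find 0%N hasT.
by rewrite -/(nsteps u omega) nth_iota // add0n.
Qed.

Lemma pivot_lt_nsteps k p : pivot (W k) = Some p -> (k < T)%N.
Proof.
move=> /pivotP[pk _]; rewrite ltnNge; apply/negP => /alive_walk_sub.
by have [_ ->] := nsteps_spec; rewrite finset.subset0 => /eqP k0; rewrite k0 inE in pk.
Qed.

Lemma lt_nsteps_pivot k : (k < T)%N -> exists p, pivot (W k) = Some p.
Proof.
move=> kT; have [Tn _] := nsteps_spec.
have := before_find 0%N kT; rewrite nth_iota ?add0n; last first.
  by rewrite ltnS ltnW // (leq_trans kT Tn).
case pk: (pivot (W k)) => [p|]; first by exists p.
by rewrite /aliveset /pos /=; move/pivot_None: pk => ->; rewrite eqxx.
Qed.

Lemma pivot_lt_n k p : pivot (W k) = Some p -> (k < n)%N.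
Proof.
by move/pivot_lt_nsteps => kT; have [Tn _] := nsteps_spec; apply: leq_trans Tn.
Qed.

(** Being the largest unfrozen index, a pivot stays pivot until it is frozen. *)
Lemma pivot_stays i j p : (i <= j)%N -> pivot (W i) = Some p ->
  p \in alive (W j) -> pivot (W j) = Some p.
Proof. by move=> ij pi pj; apply: (pivot_sub pi (alive_walk_sub ij)). Qed.

Lemma pivot_interval i j k p : (i <= j <= k)%N -> pivot (W i) = Some p ->
  pivot (W k) = Some p -> pivot (W j) = Some p.
Proof.
move=> /andP[ij jk] pi /pivotP[pk _]; apply: (pivot_stays ij pi).
exact: fintype.subsetP (alive_walk_sub jk) _ pk.
Qed.

Lemma steps_ofS k p : (k.+1 \in steps_of u omega p) = (pivot (W k) == Some p).
Proof.
rewrite mem_filter mem_iota /pivot_at /pos /= add1n ltnS.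
by case: eqP => //= /pivot_lt_nsteps.
Qed.

Lemma steps_of0 p : (0%N \in steps_of u omega p) = false.
Proof. by rewrite mem_filter mem_iota andbF. Qed.

Lemma mem_pivots p :
  reflect (exists k, pivot (W k) = Some p) (p \in pivots u omega).
Proof.
rewrite inE; apply: (iffP idP) => [|[k pk]]; last first.
  by apply/negP => /eqP s0; have := steps_ofS k p; rewrite s0 pk eqxx.
case E: (steps_of u omega p) => [//|t s] _.
have : t \in steps_of u omega p by rewrite E mem_head.
case: t {E} => [|k]; first by rewrite steps_of0.
by rewrite steps_ofS => /eqP; exists k.
Qed.

Lemma first_stepP p : p \in pivots u omega ->
  exists j, [/\ first_step u omega p = j.+1, pivot (W j) = Some p &
                forall i, pivot (W i) = Some p -> (j <= i)%N].
Proof.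
move=> /mem_pivots exP.
have exP' : exists k, pivot (W k) == Some p by case: exP => k /eqP; exists k.
case: (ex_minnP exP') => j /eqP pj jmin; exists j; split=> //; last first.
  by move=> i /eqP; apply: jmin.
apply/eqP; rewrite eqn_leq; apply/andP; split.
  have js : j.+1 \in steps_of u omega p by rewrite steps_ofS pj.
  rewrite /first_step; elim: (steps_of _ _ _) js => // t s IH.
  rewrite inE big_cons geq_min => /predU1P[->|/IH ->]; first by rewrite leqnn.
  by rewrite orbT.
rewrite /first_step big_seq; elim/big_ind: _ => [|x y jx jy|t].
- exact: pivot_lt_n pj.
- by rewrite leq_min jx.
- by case: t => [|k]; rewrite ?steps_of0 // steps_ofS ltnS; apply: jmin.
Qed.

Definition order_prefix t : seq 'I_n :=
  flatten [seq order_block u omega s | s <- iota 1 t].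

Lemma order_prefixS t :
  order_prefix t.+1 = order_prefix t ++ order_block u omega t.+1.
Proof.
rewrite /order_prefix; have -> : iota 1 t.+1 = rcons (iota 1 t) t.+1.
  by rewrite -cats1 -[in LHS](addn1 t) iotaD.
by rewrite map_rcons flatten_rcons.
Qed.

Definition fresh t := (t == 0)%N || (pivot (W t) != pivot (W t.-1)).

Lemma order_blockS t p : pivot (W t) = Some p ->
  order_block u omega t.+1 = (if fresh t then [:: p] else [::]) ++
  rev [seq j <- enum 'I_n | (j \in alive (W t) :\: alive (W t.+1)) && (j != p)].
Proof.
move=> pt; rewrite /order_block /new_pivot /pivot_at /pos /= pt.
by rewrite /fresh pt eqSS.
Qed.

(** The last pivot is listed when it becomes pivot, possibly long before it is
    frozen; no other index is listed while unfrozen. *)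
Lemma mem_order_prefix t j : (t <= T)%N -> (j \in order_prefix t) =
  (j \notin alive (W t)) || ((0 < t)%N && (pivot (W t.-1) == Some j)).
Proof.
elim: t => [|t IH] tT.
  by rewrite orbF in_alive mxE normr0 ltr01.
have [p pt] := lt_nsteps_pivot tT.
rewrite order_prefixS mem_cat (IH (ltnW tT)) (order_blockS pt) mem_cat mem_rev.
rewrite mem_filter mem_enum andbT finset.in_setD pt /= (inj_eq Some_inj) (eq_sym p).
have /pivotP[pA _] := pt.
have sub : (j \in alive (W t.+1)) ==> (j \in alive (W t)).
  by apply/implyP/fintype.subsetP/alive_walk_sub.
have freshP : (j \notin alive (W t)) || ((0 < t)%N && (pivot (W t.-1) == Some j))
    || (j \in (if fresh t then [:: p] else [::])) =
    (j \notin alive (W t)) || (j == p).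
  rewrite /fresh pt; case: t {IH tT sub} pt pA => [|t] pt pA /=.
    by rewrite orbF mem_seq1.
  case: (eqVneq (Some p) (pivot (W t))) => [<-|pnq] /=.
    by rewrite (inj_eq Some_inj) (eq_sym p) inE orbF.
  rewrite mem_seq1; case: (eqVneq (pivot (W t)) (Some j)) => [qj|]; last first.
    by rewrite orbF.
  suff -> : j \notin alive (W t.+1) by [].
  apply/negP => /(pivot_stays (leqnSn t) qj) pj.
  by move: pnq; rewrite qj -pj pt eqxx.
rewrite orbA freshP.
by move: sub; case: (j \in alive (W t)); case: (j \in alive _); case: (j == p).
Qed.

Lemma uniq_order_prefix t : (t <= T)%N -> uniq (order_prefix t).
Proof.
elim: t => [|t IH] tT //.
have [p pt] := lt_nsteps_pivot tT; have /pivotP[pA _] := pt.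
rewrite order_prefixS (order_blockS pt) !cat_uniq (IH (ltnW tT)) rev_uniq.
rewrite filter_uniq ?enum_uniq // andbT /=; apply/and3P; split.
- apply/hasPn => j; rewrite mem_cat mem_rev mem_filter mem_enum andbT.
  rewrite finset.in_setD (mem_order_prefix _ (ltnW tT)) /fresh pt.
  case/orP => [|/andP[/andP[jn jA] jp]].
    case: ifP => // fr; rewrite mem_seq1 => /eqP ->; rewrite pA /=.
    by move: fr; case: (t) => //= t'; rewrite eq_sym => /negbTE ->.
  rewrite jA /=; apply/negP => /andP[t0 /eqP tj].
  have := pivot_stays (leq_pred t) tj jA; rewrite pt => -[pj].
  by rewrite pj eqxx in jp.
- by case: ifP.
- apply/hasPn => j; rewrite mem_rev mem_filter => /andP[/andP[_ jp] _].
  by case: ifP => // _; rewrite mem_seq1.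
Qed.

Lemma mem_order_seq j : j \in order_seq u omega.
Proof.
have [_ T0] := nsteps_spec.
by rewrite (mem_order_prefix j (leqnn T)) T0 inE.
Qed.

Lemma uniq_order_seq : uniq (order_seq u omega).
Proof. exact: uniq_order_prefix. Qed.

Lemma size_order_seq : size (order_seq u omega) = n.
Proof.
rewrite -(card_uniqP uniq_order_seq) -[RHS](card_ord n); apply: eq_card => j.
by rewrite mem_order_seq.
Qed.

Local Notation sig := (sigma u omega).

Lemma sigma_inj : injective sig.
Proof.
move=> r1 r2; rewrite /sigma (set_nth_default r1 r2) ?size_rev ?size_order_seq //.
move/eqP; rewrite nth_uniq ?size_rev ?size_order_seq ?rev_uniq //.
  by move/eqP/val_inj.
exact: uniq_order_seq.
Qed.

(** For such a set the vectors [w] of its ranks span the same space as the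
    vectors [v] of its indices, so that the projection onto this space expands
    in the vectors [w]. *)
Definition lowest (S : {set 'I_n}) :=
  exists m, forall r : 'I_n, (sig r \in S) = (r < m)%N.

Lemma lowest_of_cat l1 l2 (S : {set 'I_n}) : order_seq u omega = l1 ++ l2 ->
  (forall j, (j \in l1) = (j \notin S)) -> lowest S.
Proof.
move=> cat12 l1S.
have l2S j : (j \in l2) = (j \in S).
  have := mem_order_seq j; have := uniq_order_seq.
  rewrite cat12 cat_uniq mem_cat l1S => /and3P[_ /hasPn l12 _].
  case jS: (j \in S) => //= _; apply: contraFF jS => /l12.
  by rewrite /= l1S negbK.
exists (size l2) => r; rewrite -l2S /sigma cat12 rev_cat nth_cat size_rev.
case: ltnP => [rl|lr]; first by rewrite -mem_rev mem_nth ?size_rev.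
apply/negbTE; rewrite l2S -l1S -mem_rev mem_nth // size_rev ltn_subLR //.
by have := size_order_seq; rewrite cat12 size_cat addnC => ->.
Qed.

Lemma order_seq_prefix t : (t <= T)%N ->
  exists s, order_seq u omega = order_prefix t ++ s.
Proof.
move=> tT; exists (flatten [seq order_block u omega s | s <- iota t.+1 (T - t)]).
by rewrite -flatten_cat -map_cat -add1n -iotaD subnKC.
Qed.

Lemma lowest_alive_step k p : pivot (W k) = Some p -> lowest (alive (W k) :\ p).
Proof.
move=> pk; have kT := pivot_lt_nsteps pk.
have [s] := order_seq_prefix kT; rewrite order_prefixS (order_blockS pk) -!catA.
rewrite [X in _ = X]catA => /lowest_of_cat; apply=> j.
rewrite mem_cat (mem_order_prefix _ (ltnW kT)) in_setD1 negb_and negbK /fresh pk.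
case: (eqVneq j p) => [->|jp] /=.
  case: (eqVneq k 0%N) => [->|k0] /=; first by rewrite mem_head orbT.
  rewrite lt0n k0 /= eq_sym; case: eqP => _ /=; first by rewrite orbT.
  by rewrite mem_head orbT.
have -> : (j \in (if (k == 0%N) || (Some p != pivot (W k.-1)) then [:: p] else [::])) = false.
  by case: ifP => // _; rewrite mem_seq1 (negbTE jp).
rewrite orbF; case jA: (j \in alive (W k)) => //=.
apply/negbTE/negP => /andP[_ /eqP qj].
have := pivot_stays (leq_pred k) qj jA; rewrite pk => -[pj].
by rewrite pj eqxx in jp.
Qed.

Lemma lowest_alive_next k p : pivot (W k) = Some p -> lowest (alive (W k.+1) :\ p).
Proof.
move=> pk; have kT := pivot_lt_nsteps pk.
have [s] := order_seq_prefix kT => /lowest_of_cat; apply=> j.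
by rewrite (mem_order_prefix _ kT) in_setD1 negb_and negbK pk (inj_eq Some_inj) (eq_sym p) orbC.
Qed.

Lemma lowest_alive_first k p : pivot (W k) = Some p ->
  (forall i, pivot (W i) = Some p -> (k <= i)%N) -> lowest (alive (W k)).
Proof.
move=> pk kmin; have kT := ltnW (pivot_lt_nsteps pk).
have [s] := order_seq_prefix kT => /lowest_of_cat; apply=> j.
rewrite (mem_order_prefix _ kT); case jA: (j \in alive (W k)) => //=.
apply/negbTE/negP => /andP[k0 /eqP qj].
have := pivot_stays (leq_pred k) qj jA; rewrite pk => -[pj].
by have := kmin k.-1; rewrite pj => /(_ qj); rewrite leqNgt prednK // leqnn.
Qed.

End RunTheory.

(** * Orthogonal expansion along the order of freezing *)
Section GramSchmidt.
Variables (R : realType) (d n : nat) (v : 'I_n -> 'cV[R]_d).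
Variable u : 'cV[R]_n -> 'cV[R]_n.
Hypothesis hu : gsw_rule v u.
Variable omega : n.-tuple bool.

Local Notation W := (walk u omega).
Local Notation sig := (sigma u omega).
Local Notation wv := (w v u omega).
Local Notation Qs := (Q u omega).
Local Notation fs := (first_step u omega).

Definition span_lt m : 'M[R]_d := spanmx (v \o sig) [set k : 'I_n | (k < m)%N].

Lemma span_beforeE (r : 'I_n) : span_before v u omega r = span_lt r.
Proof. by apply: eq_bigl => k; rewrite inE. Qed.

Lemma w_orth (r : 'I_n) z : (z^T <= span_lt r)%MS -> dot (wv r) z = 0.
Proof.
move=> zV; rewrite /w; case: eqP => _; first by rewrite dot0l.
by rewrite dotZl /residual span_beforeE orthproj_orth // mulr0.
Qed.

Lemma residualE (r : 'I_n) :
  residual v u omega r = norm2 (residual v u omega r) *: wv r.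
Proof.
rewrite /w; case: eqP => [->|/eqP r0]; first by rewrite scaler0.
by rewrite scalerA divff ?norm2_eq0 // scale1r.
Qed.

Lemma w_unit (r : 'I_n) : wv r != 0 -> dot (wv r) (wv r) = 1.
Proof.
rewrite /w; case: (residual v u omega r =P 0) => [_|/eqP r0 _].
  by rewrite eqxx.
by rewrite dotZl dotZr -norm2_sqr expr2 mulKf ?mulVf ?norm2_eq0.
Qed.

Lemma span_lt_gen (r : 'I_n) m : (r < m)%N -> ((v (sig r))^T <= span_lt m)%MS.
Proof. by move=> rm; apply: (spanmx_gen (v \o sig)); rewrite inE. Qed.

Lemma span_lt_sub l m : (l <= m)%N -> (span_lt l <= span_lt m)%MS.
Proof.
move=> lm; apply/sumsmx_subP => j; rewrite inE => jl.
by rewrite genmxE span_lt_gen // (leq_trans jl).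
Qed.

Lemma w_sub (r : 'I_n) m : (r < m)%N -> ((wv r)^T <= span_lt m)%MS.
Proof.
move=> rm; rewrite /w; case: eqP => _; first by rewrite trmx0 sub0mx.
rewrite linearZ scalemx_sub //= linearB addmx_sub ?span_lt_gen // eqmx_opp.
rewrite span_beforeE (submx_trans (orthproj_sub _ _)) // span_lt_sub //.
exact: ltnW.
Qed.

Lemma w_orthogonal (r s : 'I_n) : r != s -> dot (wv r) (wv s) = 0.
Proof.
rewrite -val_eqE neq_ltn => /orP[rs|sr]; last by rewrite w_orth ?w_sub.
by rewrite dotC w_orth ?w_sub.
Qed.

(** The new vector [v (sigma r)] is the sum of its projection onto the former
    span and of a multiple of [w r], and [w r] is a unit vector or zero. *)
Lemma orthproj_span_ltS (r : 'I_n) y : orthproj (span_lt r.+1) y =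
  orthproj (span_lt r) y + dot (wv r) y *: wv r.
Proof.
apply: orthproj_uniq.
  rewrite linearD addmx_sub //=.
    by rewrite (submx_trans (orthproj_sub _ _)) // span_lt_sub.
  by rewrite linearZ scalemx_sub //= w_sub.
have orthV z : (z^T <= span_lt r)%MS ->
    dot (y - (orthproj (span_lt r) y + dot (wv r) y *: wv r)) z = 0.
  by move=> zV; rewrite opprD addrA dotBl orthproj_orth // dotZl (w_orth zV) mulr0 subr0.
have orthw : dot (y - (orthproj (span_lt r) y + dot (wv r) y *: wv r)) (wv r) = 0.
  rewrite opprD addrA dotBl dotBl dotZl (dotC (orthproj _ _)).
  rewrite (w_orth (orthproj_sub _ _)) subr0.
  have [->|w0] := eqVneq (wv r) 0; first by rewrite !dot0r dot0l mulr0 subr0.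
  by rewrite w_unit // mulr1 dotC subrr.
apply: spanmx_orth => k; rewrite inE ltnS leq_eqVlt => /predU1P[kr|kr].
  have -> : k = r by apply/val_inj.
  have -> : (v \o sig) r = orthproj (span_lt r) (v (sig r)) + residual v u omega r.
    by rewrite /residual span_beforeE addrC subrK.
  by rewrite dotDr orthV ?orthproj_sub // residualE dotZr orthw mulr0 addr0.
by apply: orthV; apply: span_lt_gen.
Qed.

Lemma orthproj_span_lt m y :
  orthproj (span_lt m) y = \sum_(r < n | (r < m)%N) dot (wv r) y *: wv r.
Proof.
elim: m => [|m IH].
  rewrite big_pred0 //; apply: orthproj_uniq; first by rewrite trmx0 sub0mx.
  by apply: spanmx_orth => k; rewrite inE.
case: (ltnP m n) => [mn|nm].
  rewrite (orthproj_span_ltS (Ordinal mn)) IH /= [RHS](bigD1 (Ordinal mn)) //= addrC.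
  congr (_ + _); apply: eq_bigl => k; rewrite -val_eqE /= ltnS.
  by rewrite [in RHS]andbC -ltn_neqAle.
have E (k : 'I_n) : (k < m.+1)%N = (k < m)%N.
  by rewrite ltnS !(leq_trans _ nm) // ltnW.
have -> : span_lt m.+1 = span_lt m by apply: eq_bigl => k; rewrite !inE E.
by rewrite IH; apply: eq_bigl => k; rewrite E.
Qed.

Lemma orthproj_lowest (S : {set 'I_n}) y : lowest u omega S ->
  orthproj (spanmx v S) y = \sum_(r | sig r \in S) dot (wv r) y *: wv r.
Proof.
case=> m Sm; rewrite (eq_bigl _ _ Sm) -orthproj_span_lt.
suff -> : spanmx v S = span_lt m by [].
rewrite /spanmx (reindex_inj (sigma_inj hu (omega := omega))).
by apply: eq_bigl => r; rewrite Sm inE.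
Qed.

Lemma w_bessel y : \sum_r dot (wv r) y ^+ 2 <= dot y y.
Proof.
apply: le_trans (dot_orthproj_le (span_lt n) y).
rewrite orthproj_span_lt dot_suml (eq_bigl _ _ (fun r => ltn_ord r)).
by apply: ler_sum => r _; rewrite dotZl.
Qed.

Definition block p s : 'cV[R]_d := \sum_(r in Qs p s) dot (wv r) (v p) *: wv r.

Lemma dot_block p s x :
  dot (block p s) x = \sum_(r in Qs p s) dot (wv r) (v p) * dot (wv r) x.
Proof. by rewrite dot_suml; apply: eq_bigr => r _; rewrite dotZl. Qed.

Lemma dot_block_self p s :
  dot (block p s) (block p s) = \sum_(r in Qs p s) dot (wv r) (v p) ^+ 2.
Proof.
rewrite dot_block; apply: eq_bigr => r rQ; rewrite expr2; congr (_ * _).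
rewrite dot_sumr (bigD1 r) //= big1 ?addr0 => [|s' /andP[_ s'r]]; last first.
  by rewrite dotZr w_orthogonal ?mulr0 // eq_sym.
rewrite dotZr; have [->|w0] := eqVneq (wv r) 0; first by rewrite dot0l mul0r.
by rewrite w_unit // mulr1.
Qed.

Lemma Q_first p j : fs p = j.+1 -> Qs p j = [set r | sig r == p].
Proof. by move=> fp; rewrite /Q fp eqxx. Qed.

Lemma Q_step p k : pivot (W k) = Some p -> Qs p k.+1 =
  [set r | (sig r \in alive (W k) :\: alive (W k.+1)) && (sig r != p)].
Proof.
move=> pk; have [j [fp _ jmin]] :=
  first_stepP hu (introT (mem_pivots hu omega p) (ex_intro _ k pk)).
rewrite /Q fp /= gtn_eqF ?ltnS ?jmin // (steps_ofS hu) pk eqxx //.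
Qed.

(** The set of unfrozen indices is among the lowest ranks both with and
    without [p], and the projection of [v p] onto the span of the former is
    [v p] itself. *)
Lemma leftover_first p j : fs p = j.+1 -> pivot (W j) = Some p ->
  (forall i, pivot (W i) = Some p -> (j <= i)%N) ->
  block p j = leftover v (W j) p.
Proof.
move=> fp pj jmin; have /pivotP[pA _] := pj.
rewrite /leftover (orthproj_lowest _ (lowest_alive_step hu pj)).
have : orthproj (spanmx v (alive (W j))) (v p) = v p.
  by apply/orthproj_id/spanmx_gen.
rewrite (orthproj_lowest _ (lowest_alive_first hu pj jmin)) => {1}<-.
apply/esym/eqP; rewrite subr_eq; apply/eqP.
rewrite (bigID (fun r => sig r == p)) /=; congr (_ + _); apply: eq_bigl => r.
  by rewrite (Q_first fp) !inE; case: eqP => [->|]; rewrite ?andbF // -in_alive pA.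
by rewrite in_setD1 andbC.
Qed.

(** A block is the difference of the projections of [v p] onto two spans of
    lowest ranks, those of the unfrozen indices before and after the step. *)
Lemma leftover_step p k : pivot (W k) = Some p ->
  block p k.+1 = leftover v (W k.+1) p - leftover v (W k) p.
Proof.
move=> pk; have /fintype.subsetP sub := alive_walk_sub hu omega (leqnSn k).
rewrite /leftover opprB [RHS]addrC addrA subrK.
rewrite (orthproj_lowest _ (lowest_alive_step hu pk)).
rewrite (orthproj_lowest _ (lowest_alive_next hu pk)).
apply/esym/eqP; rewrite subr_eq; apply/eqP.
rewrite (bigID (fun r => sig r \notin alive (W k.+1))) /=.
congr (_ + _); apply: eq_bigl => r.
  by rewrite in_setD1 andbC andbCA andbC (Q_step pk) [RHS]finset.in_set finset.in_setD.
rewrite negbK !in_setD1 -andbA; congr (_ && _).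
by case: (boolP (sig r \in alive (W k.+1))) => [/sub ->|]; rewrite ?andbF.
Qed.

Lemma mem_Q p s r : p \in pivots u omega -> r \in Qs p s ->
  [/\ s.+1 = fs p & sig r = p] \/
  exists k, [/\ s = k.+1, pivot (W k) = Some p, sig r \in alive (W k),
                sig r \notin alive (W k.+1) & sig r != p].
Proof.
move=> pp; have [j [fp pj jmin]] := first_stepP hu pp.
have [->|sj] := eqVneq s j.
  by rewrite (Q_first fp) inE => /eqP; left.
case: s sj => [|k] sj; rewrite /Q fp (negbTE sj).
  by rewrite steps_of0 inE.
rewrite (steps_ofS hu); case: eqP => [pk|_]; last by rewrite inE.
rewrite inE finset.in_setD => /andP[/andP[rn ra] rp].
by right; exists k.
Qed.

(** An index is frozen only once, and a pivot is frozen while it is pivot. *)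
Lemma Q_disjoint p p' s s' r : p \in pivots u omega -> p' \in pivots u omega ->
  r \in Qs p s -> r \in Qs p' s' -> (p, s) = (p', s').
Proof.
have pivot_not_frozen q k i : q \in pivots u omega -> i = q ->
    forall q', pivot (W k) = Some q' -> i \in alive (W k) ->
    i \notin alive (W k.+1) -> i != q' -> False.
  move=> qp -> q' q'k qk qk1 qq'; have [j [_ qj _]] := first_stepP hu qp.
  have [jk|kj] := leqP j k.
    have := pivot_stays hu jk qj qk; rewrite q'k => -[q'q].
    by rewrite q'q eqxx in qq'.
  move/pivotP: qj => [qA _]; move/negP: qk1; apply.
  exact: fintype.subsetP (alive_walk_sub hu omega kj) _ qA.
have frozen_once i k k' : (k < k')%N -> i \notin alive (W k.+1) ->
    i \in alive (W k') -> False.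
  move=> kk' /negP ik ik'; apply: ik.
  exact: fintype.subsetP (alive_walk_sub hu omega kk') _ ik'.
move=> pp pp' /(mem_Q pp) rQ /(mem_Q pp') rQ'.
case: rQ rQ' => [[sf rp]|[k [-> pk rk rk1 rp]]] [[sf' rp']|[k' [-> pk' rk' rk1' rp']]].
- by rewrite -rp rp'; congr pair; apply: succn_inj; rewrite sf sf' -rp rp'.
- by case: (pivot_not_frozen _ _ _ pp rp _ pk').
- by case: (pivot_not_frozen _ _ _ pp' rp' _ pk).
- case: (ltngtP k k') => kk'.
  + by case: (frozen_once _ _ _ kk' rk1 rk').
  + by case: (frozen_once _ _ _ kk' rk1' rk).
  + by move: pk; rewrite kk' pk' => -[->].
Qed.

(** Through this bound, sums over pivots and steps are controlled by Bessel's
    inequality for all the vectors [w] at once. *)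
Lemma sum_Q_le (f : 'I_n -> R) : (forall r, 0 <= f r) ->
  \sum_(p in pivots u omega) \sum_((fs p).-1 <= s < n.+1)
     \sum_(r in Qs p s) f r <= \sum_r f r.
Proof.
move=> f0.
pose P (q : 'I_n * 'I_n.+1) :=
  (q.1 \in pivots u omega) && ((fs q.1).-1 <= q.2)%N.
pose F (q : 'I_n * 'I_n.+1) := if P q then Qs q.1 q.2 else finset.set0.
have -> : \sum_(p in pivots u omega) \sum_((fs p).-1 <= s < n.+1)
     \sum_(r in Qs p s) f r = \sum_q \sum_(r in F q) f r.
  under eq_bigr do rewrite big_geq_mkord.
  rewrite pair_big_dep /= big_mkcond; apply: eq_bigr => q _.
  by rewrite /F /P; case: ifP => // _; rewrite finset.big_set0.
rewrite -partition_disjoint_bigcup; last first.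
  move=> q q' qq'; rewrite finset.disjoints_subset /F.
  case: ifP => [/andP[pq _]|_]; last by rewrite finset.sub0set.
  case: ifP => [/andP[pq' _]|_]; last by rewrite finset.setC0 finset.subsetT.
  apply/fintype.subsetP => r rq; rewrite inE; apply: contra qq' => rq'.
  have [E1 E2] := Q_disjoint pq pq' rq rq'.
  by apply/eqP; case: q q' E1 E2 {pq pq' rq rq'} => [a b] [a' b'] /= -> /val_inj ->.
by rewrite [leRHS](bigID (mem (\bigcup_q F q)%SET)) /= lerDl sumr_ge0.
Qed.

Lemma sum_Q_le1 p (f : 'I_n -> R) : (forall r, 0 <= f r) ->
  p \in pivots u omega ->
  \sum_((fs p).-1 <= s < n.+1) \sum_(r in Qs p s) f r <= \sum_r f r.
Proof.
move=> f0 pp; apply: le_trans (sum_Q_le f0).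
rewrite [leRHS](bigD1 p) //= lerDl.
by do 3 (apply: sumr_ge0 => ? _).
Qed.

(** Bessel's inequality for each vector of the standard basis. *)
Lemma sum_w_sqr_le_d : \sum_r dot (wv r) (wv r) <= d%:R.
Proof.
rewrite exchange_big /= -[X in _ <= X%:R](card_ord d) -sumr_const.
apply: ler_sum => i _; under eq_bigr do rewrite -expr2 -dot_delta.
apply: le_trans (w_bessel _) _.
by rewrite dot_delta mxE !eqxx.
Qed.

Lemma w_sqr_le1 r : dot (wv r) (wv r) <= 1.
Proof.
have [->|w0] := eqVneq (wv r) 0; first by rewrite dot0l ler01.
by rewrite w_unit.
Qed.

Lemma sum_w_sqr_le_n : \sum_r dot (wv r) (wv r) <= n%:R.
Proof.
rewrite -[X in _ <= X%:R](card_ord n) -sumr_const.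
by apply: ler_sum => r _; apply: w_sqr_le1.
Qed.

Lemma ThatE : (That v u omega)%:R = \sum_(p in pivots u omega)
  \sum_((fs p).-1 <= s < n.+1) [exists r in Qs p s, wv r != 0]%:R :> R.
Proof.
rewrite natr_sum; apply: eq_bigr => p _.
by rewrite /nontrivial_steps -sum1_count natr_sum big_mkcond /=;
  apply: eq_bigr => s _; case: ifP.
Qed.

Lemma That_le : (That v u omega <= minn d n)%N.
Proof.
have le : (That v u omega)%:R <= \sum_r dot (wv r) (wv r) :> R.
  rewrite ThatE; apply: le_trans (sum_Q_le (fun r => dot_ge0 _)).
  apply: ler_sum => p _; apply: ler_sum => s _.
  case: exists_inP => [[r rQ w0]|_]; last by apply: sumr_ge0 => r _; apply: dot_ge0.
  rewrite (bigD1 r) //= w_unit // lerDl.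
  by apply: sumr_ge0 => r' _; apply: dot_ge0.
rewrite leq_min -!(ler_nat R).
by rewrite (le_trans le sum_w_sqr_le_d) (le_trans le sum_w_sqr_le_n).
Qed.

End GramSchmidt.

(** * Bounds on the variance proxy *)
Section Variance.
Variable R : realType.

(** Domination by geometric means, in place of products, allows weights that
    vanish together with the term. *)
Lemma sqr_sum_norm_le (I : Type) (s : seq I) (P : pred I) (a A B : I -> R) :
  (forall i, P i -> 0 <= A i) -> (forall i, P i -> 0 <= B i) ->
  (forall i, P i -> a i ^+ 2 <= A i * B i) ->
  (\sum_(i <- s | P i) `|a i|) ^+ 2 <=
  (\sum_(i <- s | P i) A i) * (\sum_(i <- s | P i) B i).
Proof.
move=> A0 B0 aAB; elim: s => [|i s IH]; first by rewrite !big_nil expr0n mul0r.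
rewrite !big_cons; case: ifP => // Pi.
have SA : 0 <= \sum_(i <- s | P i) A i by apply: sumr_ge0.
have SB : 0 <= \sum_(i <- s | P i) B i by apply: sumr_ge0.
have Sa : 0 <= \sum_(i <- s | P i) `|a i| by apply: sumr_ge0.
move: (A0 _ Pi) (B0 _ Pi) (aAB _ Pi); rewrite -real_normK ?num_real //.
move: (\sum_(i <- s | P i) A i) (\sum_(i <- s | P i) B i) SA SB IH.
move: (\sum_(i <- s | P i) `|a i|) Sa => x x0 X Y X0 Y0 xXY a0 b0 ab.
move: `|a i| (normr_ge0 (a i)) a0 b0 ab => y y0; move: (A i) (B i) => p q p0 q0 ypq.
have cross : 2 * (x * y) <= X * q + p * Y.
  rewrite -(@ler_pXn2r _ 2) ?nnegrE ?addr_ge0 ?mulr_ge0 //.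
  apply: (@le_trans _ _ (4 * ((X * Y) * (p * q)))).
    rewrite exprMn [(x * y) ^+ 2]exprMn -natrX ler_wpM2l //.
    by rewrite ler_pM ?exprn_ge0.
  rewrite -subr_ge0.
  have -> : (X * q + p * Y) ^+ 2 - 4 * (X * Y * (p * q)) = (X * q - p * Y) ^+ 2.
    by ring.
  exact: sqr_ge0.
by rewrite sqrrD mulrDl !mulrDr -mulr_natl; lra.
Qed.

Variables (d n : nat) (v : 'I_n -> 'cV[R]_d).
Variable u : 'cV[R]_n -> 'cV[R]_n.
Hypothesis hu : gsw_rule v u.
Hypothesis hv : forall i, norm2 (v i) <= 1.
Variable omega : n.-tuple bool.

Local Notation wv := (w v u omega).
Local Notation Qs := (Q u omega).
Local Notation fs := (first_step u omega).
Local Notation blk := (block v u omega).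

Lemma dot_v_le1 i : dot (v i) (v i) <= 1.
Proof.
by rewrite -norm2_sqr -(expr1n _ 2) lerXn2r ?nnegrE ?sqrtr_ge0.
Qed.

Lemma ZE x : Z v u omega x = \sum_(p in pivots u omega)
  (\sum_((fs p).-1 <= s < n.+1) `|dot (blk p s) x|) ^+ 2.
Proof.
apply: eq_bigr => p _; congr (_ ^+ 2); apply: eq_bigr => s _.
by rewrite dot_block.
Qed.

Lemma Z_ge0 x : 0 <= Z v u omega x.
Proof. by apply: sumr_ge0 => p _; apply: sqr_ge0. Qed.

Lemma sum_block_sqr_le1 p : p \in pivots u omega ->
  \sum_((fs p).-1 <= s < n.+1) dot (blk p s) (blk p s) <= 1.
Proof.
move=> pp; under eq_bigr do rewrite dot_block_self.
apply: le_trans (sum_Q_le1 hu (fun r => sqr_ge0 _) pp) _.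
exact: le_trans (w_bessel v u omega _) (dot_v_le1 p).
Qed.

Lemma Z_le x : Z v u omega x <= dot x x.
Proof.
rewrite ZE; apply: le_trans (w_bessel v u omega x).
have := sum_Q_le hu omega (fun r => sqr_ge0 (dot (wv r) x)).
apply: le_trans.
apply: ler_sum => p pp.
apply: (@le_trans _ _ ((\sum_((fs p).-1 <= s < n.+1) dot (blk p s) (blk p s))
   * (\sum_((fs p).-1 <= s < n.+1) \sum_(r in Qs p s) dot (wv r) x ^+ 2))).
  apply: sqr_sum_norm_le => s _; first exact: dot_ge0.
    by apply: sumr_ge0 => r _; apply: sqr_ge0.
  rewrite dot_block_self dot_block.
  rewrite -[leLHS]real_normK ?num_real //.
  apply: (@le_trans _ _
    ((\sum_(r in Qs p s) `|dot (wv r) (v p) * dot (wv r) x|) ^+ 2)).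
    by rewrite lerXn2r ?nnegrE ?sumr_ge0 // ler_norm_sum.
  apply: sqr_sum_norm_le => r _; rewrite ?sqr_ge0 //.
  by rewrite exprMn.
rewrite -[leRHS]mul1r ler_wpM2r ?sum_block_sqr_le1 //.
by do 2 (apply: sumr_ge0 => ? _); apply: sqr_ge0.
Qed.

(** Cauchy-Schwarz is weighted by the squared lengths [c s] of the blocks, whose
    sum is at most [1]; after summation over the coordinates each nonzero
    block is left with [c s / c s]. *)
Lemma sum_Z_le : \sum_(i < d) Z v u omega (delta_mx i 0) <= (That v u omega)%:R.
Proof.
under eq_bigr do rewrite ZE.
rewrite exchange_big /= (ThatE v); apply: ler_sum => p pp.
pose c s := dot (blk p s) (blk p s).
pose B i s := dot (blk p s) (delta_mx i 0) ^+ 2 / c s.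
apply: (@le_trans _ _ (\sum_(i < d) \sum_((fs p).-1 <= s < n.+1) B i s)).
  apply: ler_sum => i _.
  apply: (@le_trans _ _ ((\sum_((fs p).-1 <= s < n.+1) c s) *
    \sum_((fs p).-1 <= s < n.+1) B i s)).
    apply: sqr_sum_norm_le => s _; rewrite ?dot_ge0 ?divr_ge0 ?sqr_ge0 ?dot_ge0 //.
    have [c0|c0] := eqVneq (c s) 0; last by rewrite mulrC divfK.
    move/eqP: c0; rewrite dot_eq0 => /eqP ->; rewrite dot0l expr0n.
    by rewrite mulr_ge0 ?divr_ge0 ?sqr_ge0 ?dot_ge0.
  rewrite -[leRHS]mul1r ler_wpM2r ?sum_block_sqr_le1 //.
  by apply: sumr_ge0 => s _; rewrite divr_ge0 ?sqr_ge0 ?dot_ge0.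
rewrite exchange_big; apply: ler_sum => s _; rewrite -mulr_suml.
have -> : \sum_(i < d) dot (blk p s) (delta_mx i 0) ^+ 2 = c s.
  by apply: eq_bigr => i _; rewrite dot_delta expr2.
have [->|c0] := eqVneq (c s) 0; first by rewrite mul0r.
rewrite divff //; case: exists_inP => // noQ.
case/eqP: c0; rewrite /c dot_block_self big1 // => r rQ.
have [->|w0] := eqVneq (wv r) 0; first by rewrite dot0l expr0n.
by case: noQ; exists r.
Qed.

End Variance.

(** * Supermartingales along coin sequences *)
Section CoinProcess.
Variables (R : realType) (S : Type).
Variables (step : S -> bool -> S) (q : S -> bool -> R) (inv : S -> Prop).
Hypothesis inv_step : forall st c, inv st -> inv (step st c).
Hypothesis q_ge0 : forall st c, inv st -> 0 <= q st c.

Lemma sum_tuple_cons m (F : m.+1.-tuple bool -> R) :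
  \sum_t F t = \sum_c \sum_(t : m.-tuple bool) F (cons_tuple c t).
Proof.
rewrite pair_big /= (reindex (fun p : bool * m.-tuple bool => cons_tuple p.1 p.2)) //=.
exists (fun t : m.+1.-tuple bool => (thead t, behead_tuple t)) => [[c t] _|t _] /=.
  by congr pair; apply: val_inj.
by apply: val_inj; rewrite [RHS](congr1 val (tuple_eta t)).
Qed.

Fixpoint weight st (s : seq bool) : R :=
  if s is c :: s' then q st c * weight (step st c) s' else 1.

Lemma weightE st s : weight st s =
  \prod_(k < size s) q (foldl step st (take k s)) (nth true s k).
Proof.
elim: s st => [|c s IH] st /=; first by rewrite big_ord0.
by rewrite big_ord_recl /= IH.
Qed.

(** Only the process started at [st] matters, hence the induction on the number
    of remaining coins, with the first coin split off. *)
Lemma supermartingale_le (g : S -> R) m st :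
  (forall st, inv st -> \sum_c q st c * g (step st c) <= g st) -> inv st ->
  \sum_(t : m.-tuple bool) weight st t * g (foldl step st t) <= g st.
Proof.
move=> gP; elim: m st => [|m IH] st i.
  rewrite (big_pred1 [tuple]) => [|t]; first by rewrite mul1r.
  by rewrite (tuple0 t) /= eq_refl.
rewrite sum_tuple_cons; apply: le_trans (gP _ i); apply: ler_sum => c _ /=.
under eq_bigr do rewrite -mulrA.
rewrite -mulr_sumr; apply: ler_wpM2l; first exact: q_ge0.
by apply: IH; exact: inv_step.
Qed.

End CoinProcess.

(** * The law of the run *)
Section RunLaw.
Variables (R : realType) (d n : nat) (v : 'I_n -> 'cV[R]_d).
Variable u : 'cV[R]_n -> 'cV[R]_n.
Hypothesis hu : gsw_rule v u.

Lemma coin_prob_ge0 X c : 0 <= coin_prob u X c.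
Proof.
rewrite /coin_prob; case: pivot => [_|]; last by rewrite invr_ge0.
by case: c; rewrite divr_ge0 ?addr_ge0 ?normr_ge0.
Qed.

Lemma coin_prob_sum X : in_cube X -> \sum_c coin_prob u X c = 1.
Proof.
move=> cX; rewrite big_bool /= /coin_prob; case pX: (pivot X) => [p|].
  have [dp0 _ _] := deltapP hu cX pX; have [dm0 _ _] := deltamP hu cX pX.
  by rewrite -mulrDl divff // gt_eqF // addr_gt0.
by field.
Qed.

Lemma run_prob_ge0 (omega : n.-tuple bool) : 0 <= run_prob u omega.
Proof. by apply: prodr_ge0 => k _; apply: coin_prob_ge0. Qed.

Lemma walk_foldl (omega : n.-tuple bool) k : (k <= n)%N ->
  foldl (gsw_step u) 0 (take k omega) = walk u omega k.
Proof.
elim: k => [|k IH] kn; first by rewrite take0.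
by rewrite (take_nth true) ?size_tuple // foldl_rcons /= IH // ltnW.
Qed.

(** A state may record more than the position: the probability of a run is
    read off any process whose positions follow the walk. *)
Lemma run_probE (S : Type) (step : S -> bool -> S) (X : S -> 'cV[R]_n) st omega :
  X st = 0 -> (forall st c, X (step st c) = gsw_step u (X st) c) ->
  run_prob u omega = weight step (fun st => coin_prob u (X st)) st omega.
Proof.
move=> X0 XS; rewrite weightE size_tuple; apply: eq_bigr => k _.
have XE s : X (foldl step st s) = foldl (gsw_step u) 0 s.
  by elim/last_ind: s => [|s c IH] //; rewrite !foldl_rcons XS IH.
by rewrite XE walk_foldl ?(ltnW (ltn_ord k)) // (tnth_nth true).
Qed.

Lemma expect1 : expect u (fun _ : n.-tuple bool => 1) = 1.
Proof.
have le (a : R) : expect u (fun _ => a) <= a.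
  have := @supermartingale_le _ _ (gsw_step u) (coin_prob u) (@in_cube R n)
    (fun X c => gsw_step_cube hu c) (fun X c _ => coin_prob_ge0 X c)
    (fun _ => a) n 0.
  under eq_bigr do rewrite -(run_probE (X := id)) //.
  apply=> [X cX|i]; first by rewrite -mulr_suml coin_prob_sum // mul1r.
  by rewrite mxE normr0 ler01.
(* The bound for [1] and for [-1] gives both inequalities. *)
have exE a : expect u (fun _ => a) = (\sum_t run_prob u t) * a.
  by rewrite mulr_suml.
by have := le 1; have := le (-1); rewrite !exE => h1 h2; apply/eqP; rewrite eq_le; lra.
Qed.

End RunLaw.

(** * The potential of the walk *)
Section Potential.
Variables (R : realType) (d n : nat) (v : 'I_n -> 'cV[R]_d).
Variable u : 'cV[R]_n -> 'cV[R]_n.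
Hypothesis hu : gsw_rule v u.
Variable x : 'cV[R]_d.

Local Notation state := ('cV[R]_n * ('I_n -> R))%type.
Local Notation bb X p := (dot (leftover v X p) x).

Definition variation0 (p : 'I_n) : R :=
  if pivot (0 : 'cV[R]_n) == Some p then `|bb 0 p| else 0.

(** In the second case [p] has just become pivot, and its leftover counts in
    full. *)
Definition variation_incr (X X' : 'cV[R]_n) (p : 'I_n) : R :=
  if pivot X == Some p then `|bb X' p - bb X p|
  else if pivot X' == Some p then `|bb X' p| else 0.

(** Recording, next to the position, the total variation that each pivot has
    accumulated makes the potential a function of the state alone. *)
Definition vstep (st : state) (c : bool) : state :=
  let X' := gsw_step u st.1 c in
  (X', fun p => st.2 p + variation_incr st.1 X' p).

Definition vinv (st : state) : Prop :=
  [/\ in_cube st.1, forall p, 0 <= st.2 p &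
      forall p, pivot st.1 = Some p -> `|bb st.1 p| <= st.2 p].

Definition vstart : state := (0, variation0).

Lemma variation_incr_ge0 X X' p : 0 <= variation_incr X X' p.
Proof. by rewrite /variation_incr; do 2 case: ifP => // _. Qed.

Lemma vinv_start : vinv vstart.
Proof.
split=> [i|p|p] /=; first by rewrite mxE normr0 ler01.
  by rewrite /variation0; case: ifP.
by rewrite /variation0 => ->; rewrite eqxx.
Qed.

Lemma vinv_step st c : vinv st -> vinv (vstep st c).
Proof.
case: st => X f [/= cX f0 fb]; split=> [|p|p] /=.
- exact: (gsw_step_cube hu).
- by rewrite addr_ge0 ?variation_incr_ge0.
- move=> pX'; rewrite /variation_incr; case: eqP => [pX|_].
    rewrite -[bb _ p in leLHS](subrK (bb X p)) addrC.
    by rewrite (le_trans (ler_normD _ _)) // lerD2r fb.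
  by rewrite pX' eqxx lerDr.
Qed.

Variable lam : R.

(** The conditional expectation of the final exponential if the leftover of
    the current pivot were to stay the same until it is frozen, and if no
    other pivot were to follow. *)
Definition potential (st : state) : R :=
  expR (lam * dot (colmx v *m st.1) x - lam ^+ 2 / 2 * \sum_p st.2 p ^+ 2) *
  (if pivot st.1 is Some p then psi (st.1 p 0) (lam * bb st.1 p) else 1).

Lemma psi_lam_le (a b : R) : `|a| <= 1 ->
  psi a (lam * b) <= expR (lam ^+ 2 / 2 * b ^+ 2).
Proof.
by move=> a1; rewrite (le_trans (psi_le _ a1)) // exprMn ler_expR mulrAC.
Qed.

Lemma potential_start_le1 : potential vstart <= 1.
Proof.
rewrite /potential /vstart /= mulmx0 dot0l mulr0 add0r.
case p0: (pivot 0) => [p|]; last first.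
  rewrite mulr1 -[leRHS]expR0 ler_expR oppr_le0 mulr_ge0 ?divr_ge0 ?sqr_ge0 //.
  by apply: sumr_ge0 => q _; apply: sqr_ge0.
have cX : `|(0 : 'cV[R]_n) p 0| <= 1 by rewrite mxE normr0 ler01.
apply: le_trans (ler_wpM2l (expR_ge0 _) (psi_lam_le _ cX)) _.
rewrite -expRD -[leRHS]expR0 ler_expR addrC subr_le0 ler_wpM2l ?divr_ge0 ?sqr_ge0 //.
rewrite (bigD1 p) //= /variation0 p0 eqxx real_normK ?num_real // lerDl.
by apply: sumr_ge0 => q _; apply: sqr_ge0.
Qed.

(** After one step the potential is at most what it would be had the
    leftover remained the same. While the pivot survives, the change of the
    leftover is paid for by the growth of its variation; otherwise the pivot
    has reached a sign and the next one starts with a Hoeffding bound. *)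
Lemma potential_step_le X f p e : vinv (X, f) -> pivot X = Some p ->
  let X' := X + e *: u X in
  in_cube X' -> alive X' \subset alive X ->
  potential (X', fun q => f q + variation_incr X X' q) <=
  expR (lam * dot (colmx v *m X) x - lam ^+ 2 / 2 * \sum_q f q ^+ 2) *
  (expR (e * (lam * bb X p)) * psi (X p 0 + e) (lam * bb X p)).
Proof.
move=> i pX X' cX' sub; have [/= cX f0 fb] := i; rewrite /potential /=.
have X'p : X' p 0 = X p 0 + e by rewrite !mxE (rule_pivot hu pX) mulr1.
have -> : lam * dot (colmx v *m X') x =
    lam * dot (colmx v *m X) x + e * (lam * bb X p).
  rewrite mulmxDr -scalemxAr (rule_leftover hu pX) dotDl dotZl; ring.
set f' := fun q => f q + variation_incr X X' q.
have ff' q : f q ^+ 2 <= f' q ^+ 2.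
  rewrite lerXn2r ?nnegrE ?addr_ge0 ?f0 ?variation_incr_ge0 //.
  by rewrite lerDl variation_incr_ge0.
have l2 : 0 <= lam ^+ 2 / 2 by rewrite divr_ge0 ?sqr_ge0.
set D := lam * dot (colmx v *m X) x.
rewrite [leRHS]mulrA -expRD.
suff [y [psiy fy]] : exists y, (if pivot X' is Some q
        then psi (X' q 0) (lam * bb X' q) else 1)
      <= psi (X p 0 + e) (lam * bb X p) * expR (lam ^+ 2 / 2 * y) /\
    \sum_q f q ^+ 2 + y <= \sum_q f' q ^+ 2.
  apply: le_trans (ler_wpM2l (expR_ge0 _) psiy) _.
  rewrite mulrCA mulrC ler_wpM2r ?psi_ge0 -?X'p ?cX' // -expRD ler_expR.
  have := ler_wpM2l l2 fy; rewrite mulrDr; lra.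
have sum_grow q y : f q ^+ 2 + y <= f' q ^+ 2 ->
    \sum_q f q ^+ 2 + y <= \sum_q f' q ^+ 2.
  move=> fq; rewrite (bigD1 q) //= [leRHS](bigD1 q) //= addrAC lerD //.
  by apply: ler_sum => q' _; exact: ff'.
have [pX'|pX'] := eqVneq (pivot X') (Some p).
  rewrite pX' X'p; set a := bb X' p - bb X p.
  exists (2 * (`|bb X p| * `|a|) + a ^+ 2); split.
    have -> : lam * bb X' p = lam * bb X p + lam * a by rewrite -mulrDr addrC subrK.
    have x1 : `|X p 0 + e| <= 1 by rewrite -X'p.
    apply: le_trans (psi_shift _ _ x1) _.
    rewrite ler_wpM2l ?psi_ge0 // ler_expR !normrM exprMn.
    have -> : `|lam| * `|bb X p| * (`|lam| * `|a|) =
        `|lam| ^+ 2 * (`|bb X p| * `|a|) by ring.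
    by rewrite real_normK ?num_real //; lra.
  apply: (sum_grow p); rewrite /f' /variation_incr pX eqxx -/a.
  rewrite -(real_normK (num_real a)).
  have -> : (f p + `|a|) ^+ 2 =
    f p ^+ 2 + (2 * (f p * `|a|) + `|a| ^+ 2) by ring.
  by rewrite lerD2l lerD2r ler_wpM2l // ler_wpM2r // fb.
have Xp1 : `|X p 0 + e| = 1.
  rewrite -X'p; apply/eqP; rewrite eq_le cX' leNgt -in_alive.
  by apply: contra pX' => /(pivot_sub pX sub) ->.
rewrite (psi_sign _ Xp1).
case qX': (pivot X') => [q|]; last first.
  exists 0; rewrite mul1r mulr0 expR0 addr0; split=> //.
  by apply: ler_sum => q _; exact: ff'.
exists (bb X' q ^+ 2); split; first by rewrite mul1r; apply: psi_lam_le.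
apply: (sum_grow q); rewrite /f' /variation_incr pX qX' eqxx.
have -> : (Some p == Some q) = false by rewrite eq_sym -qX'; apply/negbTE.
by rewrite sqrrD real_normK ?num_real // lerD2r lerDl mulrn_wge0 // mulr_ge0.
Qed.

Lemma potential_supermartingale st : vinv st ->
  \sum_c coin_prob u st.1 c * potential (vstep st c) <= potential st.
Proof.
case: st => X f i; have [/= cX f0 fb] := i; rewrite big_bool /=.
case pX: (pivot X) => [p|]; last first.
  have idle c : vstep (X, f) c = (X, fun p => f p + 0).
    rewrite /vstep /= /gsw_step pX; congr pair.
    by apply/boolp.funext => p; rewrite /variation_incr pX.
  rewrite !idle /coin_prob pX -mulrDl.
  have -> : (fun p => f p + 0) = f by apply/boolp.funext => p; rewrite addr0.
  have half2 : 2^-1 + 2^-1 = 1 :> R by field.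
  by rewrite half2 mul1r.
have [dp0 cp _] := deltapP hu cX pX; have [dm0 cm _] := deltamP hu cX pX.
have sub c := gsw_step_alive hu X c.
have stepP := potential_step_le i pX.
have subp := sub true; have subm := sub false.
rewrite (gsw_stepE _ _ pX) in subp; rewrite (gsw_stepE _ _ pX) in subm.
rewrite /vstep /= !(gsw_stepE _ _ pX) /coin_prob pX.
set dp := deltap u X in dp0 cp subp *; set dm := deltam u X in dm0 cm subm *.
have s0 : 0 < dm + dp by rewrite addr_gt0.
set K := expR (lam * dot (colmx v *m X) x - lam ^+ 2 / 2 * \sum_q f q ^+ 2)
  in stepP.
apply: (@le_trans _ _ (K * (
    dm / (dm + dp) * (expR (dp * (lam * bb X p)) * psi (X p 0 + dp) (lam * bb X p)) +
    dp / (dm + dp) * (expR (- dm * (lam * bb X p)) * psi (X p 0 + - dm) (lam * bb X p))))).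
  rewrite mulrDr (mulrCA K (dm / _)) (mulrCA K (dp / _)).
  by apply: lerD; apply: ler_wpM2l;
    rewrite ?divr_ge0 ?(ltW s0) ?(ltW dp0) ?(ltW dm0) //; apply: stepP.
rewrite /potential /= pX ler_wpM2l ?expR_ge0 //.
set b := lam * bb X p.
have aff e : expR (e * b) * psi (X p 0 + e) b =
    expR (- (X p 0 * b)) *
    ((1 + (X p 0 + e)) / 2 * expR b + (1 - (X p 0 + e)) / 2 * expR (- b)).
  rewrite psi_affine mulrA -expRD; congr (expR _ * _); ring.
rewrite (aff dp) (aff (- dm)) psi_affine le_eqVlt; apply/orP; left; apply/eqP.
by field; rewrite gt_eqF.
Qed.

Lemma vstep_walk (omega : n.-tuple bool) k : (k <= n)%N ->
  (foldl vstep vstart (take k omega)).1 = walk u omega k.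
Proof.
move=> kn; rewrite -walk_foldl //.
by elim/last_ind: (take k omega) => [|s c IH] //; rewrite !foldl_rcons /= IH.
Qed.

(** Each increment of the variation is the norm of one term of the inner sum
    of [Z]: the first step of [p] as pivot contributes its whole leftover, and
    each later step the change of the leftover. *)
Lemma variation_le (omega : n.-tuple bool) k p : (k <= n)%N ->
  p \in pivots u omega ->
  (foldl vstep vstart (take k omega)).2 p <=
  \sum_((first_step u omega p).-1 <= s < n.+1 | (s <= k)%N)
     `|dot (block v u omega p s) x|.
Proof.
move=> kn pp; have [j [fp pj jmin]] := first_stepP hu pp; rewrite fp /=.
have jn := pivot_lt_n hu pj.
elim: k kn => [|k IH] kn.
  rewrite take0 /= /variation0; case: eqP => [p0|_]; last exact: sumr_ge0.
  have j0 : j = 0%N by apply/eqP; rewrite -leqn0 jmin.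
  rewrite j0 in fp pj jmin *.
  rewrite big_mkcond big_ltn //= (leftover_first hu fp pj jmin) lerDl.
  by apply: sumr_ge0 => s _; case: ifP.
rewrite (take_nth true) ?size_tuple // foldl_rcons /= vstep_walk ?(ltnW kn) //.
have [jk|kj] := leqP j k.+1; last first.
  rewrite (_ : variation_incr _ _ _ = 0).
    rewrite addr0 (le_trans (IH (ltnW kn))) //.
    rewrite [leLHS]big_mkcond [leRHS]big_mkcond; apply: ler_sum => s _.
    by case: (leqP s k) => [sk|_]; [rewrite (leqW sk)|case: ifP].
  rewrite /variation_incr; case: eqP => [/jmin|_]; first by lia.
  by case: eqP => // /(jmin k.+1); lia.
have split_last (F : nat -> R) : \sum_(j <= s < n.+1 | (s <= k.+1)%N) F s =
    \sum_(j <= s < n.+1 | (s <= k)%N) F s + F k.+1.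
  have kI : k.+1 \in index_iota j n.+1 by rewrite mem_index_iota jk.
  rewrite [LHS]big_mkcond [in RHS]big_mkcond !(bigD1_seq k.+1 kI (iota_uniq _ _)) /=.
  rewrite leqnn ltnn add0r addrC; congr (_ + _); apply: eq_bigr => s sk.
  by rewrite leq_eqVlt (negbTE sk).
rewrite split_last lerD ?IH ?(ltnW kn) //.
rewrite /variation_incr; case: eqP => [pk|pk].
  by rewrite (leftover_step hu pk) dotBl.
case: eqP => // pk1; suff kE : j = k.+1.
  by rewrite kE in fp pj jmin; rewrite (leftover_first hu fp pj jmin).
apply/eqP; rewrite eqn_leq jk ltnNge; apply/negP => jk'; apply: pk.
have pk1' : pivot (walk u omega k.+1) = Some p := pk1.
by apply: (@pivot_interval _ _ _ v _ hu omega j k k.+1) => //; rewrite jk' leqnSn.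
Qed.

Lemma variation_eq0 (omega : n.-tuple bool) k p : (k <= n)%N ->
  p \notin pivots u omega -> (foldl vstep vstart (take k omega)).2 p = 0.
Proof.
move=> kn pp.
have npp i : pivot (walk u omega i) <> Some p.
  by move=> pi; move/(mem_pivots hu): pp; apply; exists i.
elim: k kn => [|k IH] kn.
  by rewrite take0 /= /variation0; case: eqP => // /(npp 0%N).
rewrite (take_nth true) ?size_tuple // foldl_rcons /= vstep_walk ?(ltnW kn) //.
rewrite IH ?(ltnW kn) // add0r /variation_incr.
by case: eqP => [/npp//|_]; case: eqP => [/(npp k.+1)//|].
Qed.

Lemma sum_variation_le_Z (omega : n.-tuple bool) :
  \sum_p (foldl vstep vstart omega).2 p ^+ 2 <= Z v u omega x.
Proof.
have tn : take n omega = omega by rewrite take_oversize ?size_tuple.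
have inv_take s : vinv (foldl vstep vstart s).
  by elim/last_ind: s => [|s c]; [exact: vinv_start|rewrite foldl_rcons; exact: vinv_step].
rewrite ZE (bigID (mem (pivots u omega))) /= [X in _ + X]big1 ?addr0.
  apply: ler_sum => p pp; have [_ f0 _] := inv_take omega.
  rewrite lerXn2r ?nnegrE ?sumr_ge0 ?f0 //.
  have := variation_le (leqnn n) pp; rewrite tn => /le_trans; apply.
  rewrite big_mkcond; apply: ler_sum => s _; by case: ifP.
by move=> p /(variation_eq0 (leqnn n)); rewrite tn => ->; rewrite expr0n.
Qed.

Lemma expect_expR_le1 : expect u (fun omega =>
  expR (lam * dot (colmx v *m walk u omega n) x - lam ^+ 2 / 2 * Z v u omega x)) <= 1.
Proof.
apply: le_trans potential_start_le1.
apply: le_trans (@supermartingale_le _ _ vstep (fun st => coin_prob u st.1)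
  vinv vinv_step (fun st c _ => coin_prob_ge0 u st.1 c) potential n vstart
  potential_supermartingale vinv_start).
apply: ler_sum => omega _.
rewrite -(run_probE (X := fst)) // ler_wpM2l ?run_prob_ge0 //.
have tn : take n omega = omega by rewrite take_oversize ?size_tuple.
have := vstep_walk omega (leqnn n); rewrite tn /potential => ->.
have /pivot_None -> := alive_walk_end hu omega.
rewrite mulr1 ler_expR lerD2l lerN2 ler_wpM2l ?divr_ge0 ?sqr_ge0 //.
exact: sum_variation_le_Z.
Qed.

End Potential.

(** * Existence of a good run *)
Section Existence.
Variables (R : realType) (d n : nat) (v : 'I_n -> 'cV[R]_d).
Variable u : 'cV[R]_n -> 'cV[R]_n.
Hypothesis hu : gsw_rule v u.
Hypothesis hv : forall i, norm2 (v i) <= 1.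

Local Notation E := (expect u).
Local Notation Zi omega i := (Z v u omega (delta_mx i 0)).

Lemma expect_le (f g : n.-tuple bool -> R) :
  (forall omega, f omega <= g omega) -> E f <= E g.
Proof. by move=> fg; apply: ler_sum => t _; rewrite ler_wpM2l ?run_prob_ge0. Qed.

Lemma expectD f g : E (fun t => f t + g t) = E f + E g.
Proof. by rewrite /expect -big_split; apply: eq_bigr => t _; rewrite mulrDr. Qed.

Lemma expectZ a f : E (fun t => a * f t) = a * E f.
Proof. by rewrite /expect mulr_sumr; apply: eq_bigr => t _; rewrite mulrCA. Qed.

Lemma expect_sum (I : finType) (f : I -> n.-tuple bool -> R) :
  E (fun t => \sum_i f i t) = \sum_i E (f i).
Proof.
by rewrite /expect exchange_big; apply: eq_bigr => t _; rewrite mulr_sumr.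
Qed.

Lemma expect_cst a : E (fun _ => a) = a.
Proof.
by rewrite -[RHS]mulr1 -(expect1 hu) -expectZ; apply: eq_bigr => t _; rewrite mulr1.
Qed.

Definition disc (omega : n.-tuple bool) (i : 'I_d) : R :=
  dot (colmx v *m walk u omega n) (delta_mx i 0).

Let G omega : R := \big[Num.max/0]_(i < d) Zi omega i.

Lemma Z_delta_le1 omega i : Zi omega i <= 1.
Proof. by have := Z_le hu hv omega (delta_mx i 0); rewrite dot_delta mxE !eqxx. Qed.

Let ZG omega i : Zi omega i <= G omega.
Proof. exact: (le_bigmax _ (fun i => Zi omega i)). Qed.

Let cosh (y : R) : R := (expR y + expR (- y)) / 2.

Let cosh_le a b : 0 <= a -> a <= `|b| -> cosh a <= cosh b.
Proof.
move=> a0 ab; have -> : cosh b = cosh `|b|.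
  by rewrite /cosh; case: ger0P => // _; rewrite opprK addrC.
rewrite /cosh ler_pM2r ?invr_gt0 // !expRN.
move: `|b| ab => c ac.
have pa := expR_gt0 a; have pc := expR_gt0 c.
have e1 : 1 <= expR a by rewrite -[leLHS]expR0 ler_expR.
have e2 : expR a <= expR c by rewrite ler_expR.
move: (expR a) (expR c) pa pc e1 e2 => p q p0 q0 p1 pq.
rewrite -subr_ge0.
have -> : q + q^-1 - (p + p^-1) = (q - p) * (p * q - 1) / (p * q).
  by field; rewrite !gt_eqF.
rewrite divr_ge0 ?mulr_ge0 ?subr_ge0 ?(ltW p0) ?(ltW q0) //.
by rewrite mulr_ege1 // (le_trans p1).
Qed.

Lemma expect_cosh_le1 lam i :
  E (fun omega => expR (- (lam ^+ 2 / 2 * Zi omega i)) * cosh (lam * disc omega i)) <= 1.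
Proof.
have h (l : R) : l ^+ 2 = lam ^+ 2 ->
    E (fun omega => expR (- (lam ^+ 2 / 2 * Zi omega i)) * expR (l * disc omega i)) <= 1.
  move=> ll; apply: le_trans (expect_expR_le1 hu (delta_mx i 0) l).
  by apply: expect_le => t; rewrite -expRD addrC ll.
have -> : E (fun omega => expR (- (lam ^+ 2 / 2 * Zi omega i)) * cosh (lam * disc omega i))
  = 2^-1 * (E (fun omega => expR (- (lam ^+ 2 / 2 * Zi omega i)) * expR (lam * disc omega i))
     + E (fun omega => expR (- (lam ^+ 2 / 2 * Zi omega i)) * expR (- lam * disc omega i))).
  rewrite -expectD -expectZ; apply: eq_bigr => t _; congr (_ * _).
  by rewrite /cosh mulNr; field.
have h1 := h lam erefl; have h2 := h (- lam) (sqrrN lam); lra.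
Qed.

(** Subtracting [1] from the hyperbolic cosine leaves, for each coordinate, a
    contribution proportional to its own [Z]; the sum over the coordinates is
    then governed by [That] instead of by the dimension. *)
Lemma expect_sum_cosh_le lam :
  E (fun omega => \sum_i expR (- (lam ^+ 2 / 2 * Zi omega i)) *
                    (cosh (lam * disc omega i) - 1))
  <= lam ^+ 2 / 2 * E (fun omega => (That v u omega)%:R).
Proof.
have l2 : 0 <= lam ^+ 2 / 2 by rewrite divr_ge0 ?sqr_ge0.
set s := lam ^+ 2 / 2 in l2 *.
apply: (@le_trans _ _ (E (fun omega => s * \sum_i Zi omega i))); last first.
  by rewrite -expectZ; apply: expect_le => t; rewrite ler_wpM2l ?sum_Z_le.
rewrite expectZ !expect_sum mulr_sumr; apply: ler_sum => i _.
have := expect_cosh_le1 lam i; rewrite -/s => h.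
apply: (@le_trans _ _ (E (fun omega => expR (- (s * Zi omega i)) * cosh (lam * disc omega i)
   + (s * Zi omega i + - 1)))).
  apply: expect_le => t; rewrite mulrBr mulr1 lerD2l.
  by have := expR_ge1Dx (- (s * Zi t i)); lra.
by rewrite !expectD expectZ expect_cst; lra.
Qed.

(** Jensen's inequality, through the tangent of the exponential at the mean. *)
Lemma expect_expRN_ge (s : R) (f : n.-tuple bool -> R) :
  expR (- (s * E f)) <= E (fun omega => expR (- (s * f omega))).
Proof.
set m := E f.
apply: (@le_trans _ _ (E (fun t => expR (- (s * m)) * (1 + s * m + (- s) * f t)))).
  rewrite expectZ expectD expect_cst expectZ -/m.
  by rewrite le_eqVlt; apply/orP; left; apply/eqP; ring.
apply: expect_le => t.
have -> : - (s * f t) = - (s * m) + (s * m - s * f t) by ring.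
rewrite expRD ler_wpM2l ?expR_ge0 // mulNr -addrA.
exact: expR_ge1Dx.
Qed.

(** Otherwise every run has a large coordinate, whose term alone bounds the sum
    of [expect_sum_cosh_le] from below; together with Jensen's inequality this
    contradicts [expR_growth]. *)
Lemma exists_small_disc (B L : R) : 0 < L -> 2 <= B ->
  E (fun omega => (That v u omega)%:R) <= expR L -> 8 * E G * L <= B ^+ 2 ->
  exists omega, forall i, `|disc omega i| <= B.
Proof.
move=> L0 B2 tauL gB.
case: (boolP [exists omega : n.-tuple bool, [forall i, `|disc omega i| <= B]]).
  by case/existsP => omega /forallP; exists omega.
rewrite negb_exists => /forallP large; exfalso.
have B0 : 0 < B by lra.
(* With this [lam], [lam * B] is [4 * L], while [s * E G] is at most [L]. *)
pose lam := 4 * L / B; pose s := lam ^+ 2 / 2.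
have lB : lam * B = 4 * L by rewrite /lam divfK // gt_eqF.
have lam0 : 0 < lam by rewrite /lam divr_gt0 ?mulr_gt0.
have s0 : 0 <= s by rewrite /s divr_ge0 ?sqr_ge0.
have sB : s * B ^+ 2 = 8 * L ^+ 2.
  have -> : s * B ^+ 2 = (lam * B) ^+ 2 / 2 by rewrite /s; ring.
  by rewrite lB; field.
have sL : s <= 2 * L ^+ 2.
  have : 4 <= B ^+ 2 by nra.
  by move=> B4; have := ler_wpM2l s0 B4; rewrite sB; lra.
have sg : s * E G <= L.
  have := ler_wpM2l s0 gB; rewrite sB => h.
  rewrite -(@ler_pM2l _ (8 * L)) ?mulr_gt0 //; lra.
have c0 : 0 <= cosh (4 * L) - 1.
  have := expR_growth L0; have : 0 <= 2 * L ^+ 2 * expR (L + L).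
    by rewrite !mulr_ge0 ?expR_ge0 ?(ltW L0).
  by rewrite /cosh; lra.
have lower : (cosh (4 * L) - 1) * expR (- (s * E G)) <= s * expR L.
  apply: le_trans (ler_wpM2l c0 (expect_expRN_ge s G)) _.
  apply: le_trans (ler_wpM2l s0 tauL); apply: le_trans (expect_sum_cosh_le lam).
  rewrite -expectZ; apply: expect_le => t.
  have := large t; rewrite negb_forall => /existsP[i]; rewrite -ltNge => iB.
  have cosh1 j : 0 <= cosh (lam * disc t j) - 1.
    have : cosh 0 <= cosh (lam * disc t j) by apply: cosh_le.
    by rewrite {1}/cosh oppr0 expR0; lra.
  rewrite (bigD1 i) //= mulrC -[leLHS]addr0; apply: lerD; last first.
    by apply: sumr_ge0 => j _; rewrite mulr_ge0 ?expR_ge0.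
  apply: ler_pM; rewrite ?expR_ge0 //.
    by rewrite ler_expR lerN2 ler_wpM2l ?ZG.
  rewrite lerD2r cosh_le ?mulr_ge0 ?(ltW L0) //.
  by rewrite normrM (gtr0_norm lam0) -lB ler_pM2l // ltW.
have : cosh (4 * L) - 1 <= 2 * L ^+ 2 * expR (L + L).
  have -> : cosh (4 * L) - 1 =
      (cosh (4 * L) - 1) * expR (- (s * E G)) * expR (s * E G).
    by rewrite -mulrA -expRD addNr expR0 mulr1.
  apply: le_trans (ler_wpM2r (expR_ge0 _) lower) _.
  have eL := expR_ge0 L; rewrite expRD mulrA.
  apply: ler_pM; [exact: mulr_ge0|exact: expR_ge0|exact: ler_wpM2r|].
  by rewrite ler_expR.
by rewrite leNgt /cosh expR_growth.
Qed.

Lemma walk_end_sign omega i : walk u omega n i 0 = 1 \/ walk u omega n i 0 = -1.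
Proof.
have c := walk_cube hu omega n i.
have a : i \notin alive (walk u omega n) by rewrite (alive_walk_end hu) inE.
move: a; rewrite in_alive -leNgt => a.
have : `|walk u omega n i 0| = 1 by apply/eqP; rewrite eq_le c a.
case: (ler0P (walk u omega n i 0)) => _ h; [right|left] => //.
by rewrite -h opprK.
Qed.

Lemma expect_max_Z_bounds : 0 <= E G <= 1.
Proof.
apply/andP; split.
  rewrite -(expect_cst 0); apply: expect_le => t; exact: bigmax_ge_id.
rewrite -[leRHS]expect_cst; apply: expect_le => t.
by apply/bigmax_leP; split=> // i _; apply: Z_delta_le1.
Qed.

End Existence.

Theorem theorem3 (R : realType) (d n : nat) (v : 'I_n -> 'cV[R]_d)
    (u : 'cV[R]_n -> 'cV[R]_n)
    (hv : forall i : 'I_n, norm2 (v i) <= 1)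
    (hu : gsw_rule v u) :
  (forall (omega : n.-tuple bool) (i : 'I_d),
     0 <= Z v u omega (delta_mx i 0) <= 1) /\
  (forall omega : n.-tuple bool, (That v u omega <= minn d n)%N) /\
  (exists X : 'I_n -> R,
     (forall i : 'I_n, X i = 1 \/ X i = -1) /\
     `|\sum_(i < n) X i *: v i| <=
       if [forall i, v i == 0] then 2
       else 2 * Num.max 1
              (Num.sqrt (2 * expect u (fun omega =>
                   \big[Num.max/0]_(i < d) Z v u omega (delta_mx i 0))) *
               Num.sqrt (ln (expect u (fun omega => (That v u omega)%:R))))).
Proof.
split=> [omega i|]; first by rewrite Z_ge0 Z_delta_le1.
split=> [omega|]; first exact: That_le.
case: ifP => [/forallP v0|_].
  exists (fun _ => 1); split=> [i|]; first by left.
  by rewrite big1 ?normr0 // => i _; rewrite (eqP (v0 i)) scaler0.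
set g := expect u _; set tau := expect u _.
have /andP[g0 g1] : 0 <= g <= 1 := expect_max_Z_bounds hu hv.
set B := 2 * _.
have B2 : 2 <= B by rewrite /B -[leLHS]mulr1 ler_wpM2l // le_max lexx.
(* Where [ln tau] is small or negative, [1 / 2] is admissible because
   [g <= 1] and [2 <= B]. *)
pose L := Num.max (ln tau) (1 / 2).
have L0 : 0 < L by rewrite /L lt_max; apply/orP; right; lra.
have tauL : tau <= expR L.
  have [t0|t0] := ltP 0 tau; last by rewrite (le_trans t0) ?expR_ge0.
  by rewrite -[leLHS]lnK ?posrE // ler_expR le_max lexx.
have gB : 8 * g * L <= B ^+ 2.
  rewrite /L; case: (leP (ln tau) (1 / 2)) => [_|tL]; first by nra.
  have : 2 * (Num.sqrt (2 * g) * Num.sqrt (ln tau)) <= B.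
    by rewrite /B ler_wpM2l // le_max lexx orbT.
  have sq0 : 0 <= 2 * (Num.sqrt (2 * g) * Num.sqrt (ln tau)).
    by rewrite !mulr_ge0 ?sqrtr_ge0.
  have B0 : 0 <= B by lra.
  move=> sqB; have := lerXn2r 2 sq0 B0 sqB.
  have ln0 : 0 <= ln tau by lra.
  by rewrite !exprMn !sqr_sqrtr ?mulr_ge0 //; lra.
have [omega small] := exists_small_disc hu hv L0 B2 tauL gB.
exists (fun i => walk u omega n i 0); split; first exact: (walk_end_sign hu).
rewrite -colmx_mulE [leLHS]/Num.Def.normr /= mx_normrE.
apply/bigmax_leP; split=> [|[i j] _] /=; first by lra.
by have := small i; rewrite /disc dot_delta (ord1 j).
Qed.
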